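(* Let $k\ge 2$ be an integer and let $G=(V,E)$ be a $k$-Helly graph with $n$ vertices and $m$ edges. There is a randomized algorithm that, given $G$ and $k$, with high probability computes the radius $rad(G) = \min_{v\in V} \max_{u\in V} dist(u,v)$ in $\tilde{\mathcal O}(m\sqrt{kn})$ time.
   Context: For a graph $G=(V,E)$, $dist(u,v)$ is the number of edges of a shortest $uv$-path, and the ball of center $v$ and radius $r\ge 0$ is $N^r[v] = \{u \in V \mid dist(u,v)\le r\}$. A family of sets is $k$-wise intersecting if every subfamily of at most $k$ of its members has a nonempty common intersection. A graph is $k$-Helly if every $k$-wise intersecting family of balls has a nonempty common intersection. ''With high probability'' means with probability at least $1 - 1/n^{c'}$ for some constant $c'>0$; $\tilde{\mathcal O}(\cdot)$ hides polylogarithmic factors in $n$. *)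

(* Defs.v *)
From mathcomp Require Import all_boot all_order all_algebra.
From mathcomp Require Import reals exp.

Set Implicit Arguments.
Unset Strict Implicit.
Unset Printing Implicit Defensive.

Import Order.TTheory GRing.Theory Num.Theory.

(* A finite simple graph is a symmetric irreflexive relation e on a finType T. *)

Definition has_path_of_length (T : finType) (e : rel T) (u v : T) (l : nat) :=
  [exists p : l.-tuple T, [&& path e u p, last u p == v & uniq (u :: p)]].

(* When no uv-path exists this is #|T|, which stands for infinity: a path has  *)
(* fewer than #|T| edges, so no finite distance equals it (graph_dist_ltE).    *)
Definition graph_dist (T : finType) (e : rel T) (u v : T) : nat :=
  find (has_path_of_length e u v) (iota 0 #|T|).

Lemma graph_dist_ltE (T : finType) (e : rel T) (u v : T) :
  (graph_dist e u v < #|T|) = connect e u v.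
Proof.
rewrite /graph_dist -[X in _ < X](size_iota 0) -has_find.
apply/hasP/connectP => [[l _ /existsP[p /and3P[pp /eqP <- _]]]|[p]].
  by exists (tval p).
case/shortenP=> q pq uq _ ->; exists (size q).
  rewrite mem_iota add0n /= -[(size q).+1]/(size (u :: q)) -(card_uniqP uq).
  exact: max_card.
by apply/existsP; exists (in_tuple q); rewrite pq eqxx.
Qed.

(* The guard makes a vertex at infinite distance lie in no ball, whatever r.   *)
Definition graph_ball (T : finType) (e : rel T) (v : T) (r : nat) : {set T} :=
  [set u | connect e u v && (graph_dist e u v <= r)].

(* Eccentricities are at most #|T|, so the neutral element #|T| of the minimum *)
(* is harmless; the radius is #|T| exactly when it is infinite.                *)
Definition graph_radius (T : finType) (e : rel T) : nat :=
  \big[minn/#|T|]_(v : T) \max_(u : T) graph_dist e u v.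

Definition edge_set (T : finType) (e : rel T) : {set {set T}} :=
  [set [set p.1; p.2] | p : T * T & e p.1 p.2].

Definition k_wise_intersecting (T : finType) (k : nat) (F : {set {set T}}) :=
  forall S : {set {set T}}, S \subset F -> #|S| <= k ->
    \bigcap_(B in S) B != set0.

Definition k_helly (T : finType) (e : rel T) (k : nat) :=
  forall F : {set {set T}},
    (forall B, B \in F -> exists v r, B = graph_ball e v r) ->
    k_wise_intersecting k F -> \bigcap_(B in F) B != set0.

(* Randomized word RAM with w-bit words, programmed in a structured language.  *)
(* Registers are named by numbers (a program mentions finitely many); memory   *)
(* is addressed by words; results are reduced modulo 2 ^ w.                    *)

Inductive binop := OpAdd | OpSub | OpMul | OpDiv | OpMod | OpEq | OpLt.

Inductive cmd :=
  | Const (x a : nat)              (* x := a *)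
  | Binop (o : binop) (x y z : nat) (* x := y o z *)
  | Read (x y : nat)               (* x := memory[y] *)
  | Write (x y : nat)              (* memory[x] := y *)
  | Flip (x : nat)                 (* x := a fresh fair coin, 0 or 1 *)
  | Seq (c1 c2 : cmd)
  | If (x : nat) (c1 c2 : cmd)     (* c1 when x is nonzero *)
  | While (x : nat) (c1 : cmd).    (* repeat c1 while x is nonzero *)

(* OpSub is truncated at 0; division by 0 gives 0 and x mod 0 is x.            *)
Definition eval_binop (o : binop) (x y : nat) : nat :=
  match o with
  | OpAdd => x + y
  | OpSub => x - y
  | OpMul => x * y
  | OpDiv => x %/ y
  | OpMod => x %% y
  | OpEq => x == y
  | OpLt => x < y
  end.

Record state := State {
  regs : nat -> nat;
  memory : nat -> nat;
  coins : seq bool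
}.

Definition upd (f : nat -> nat) (i x : nat) : nat -> nat :=
  fun j => if j == i then x else f j.

Definition set_reg (w : nat) (s : state) (x a : nat) : state :=
  State (upd (regs s) x (a %% 2 ^ w)) (memory s) (coins s).

(* A configuration carries the stack of commands still to be executed; the     *)
(* machine has halted when it is empty. Each step costs one unit of time.      *)
Definition config := (seq cmd * state)%type.

Definition step (w : nat) (cf : config) : config :=
  let s := cf.2 in
  if cf.1 isn't c :: K then cf else
  match c with
  | Const x a => (K, set_reg w s x a)
  | Binop o x y z => (K, set_reg w s x (eval_binop o (regs s y) (regs s z)))
  | Read x y => (K, set_reg w s x (memory s (regs s y)))
  | Write x y =>
      (K, State (regs s) (upd (memory s) (regs s x) (regs s y)) (coins s))
  | Flip x => (K, set_reg w (State (regs s) (memory s) (behead (coins s)))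
                          x (head false (coins s)))
  | Seq c1 c2 => ([:: c1, c2 & K], s)
  | If x c1 c2 => ((if regs s x != 0 then c1 else c2) :: K, s)
  | While x c1 => (if regs s x != 0 then [:: c1, c & K] else K, s)
  end.

Definition init (w : nat) (prog : cmd) (input : seq nat) (r : seq bool) :
    config :=
  ([:: prog], State (fun=> 0) (fun a => nth 0 input a %% 2 ^ w) r).

(* The output is read in register 0. *)
Definition outputs_within (w : nat) (prog : cmd) (input : seq nat) (T : nat)
    (out : nat) (r : seq bool) : bool :=
  let cf := iter T (step w) (init w prog input r) in
  nilp cf.1 && (regs cf.2 0 == out).

(* A run of T steps uses at most T coins, so the coin space of T fair bits is  *)
(* large enough.                                                               *)
Definition prob_outputs_within (R : realType) (w : nat) (prog : cmd)
    (input : seq nat) (T : nat) (out : nat) : R :=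
  (#|[set r : T.-tuple bool | outputs_within w prog input T out r]|%:R
    / (2 ^ T)%:R)%R.

(* Neighbours may be listed in any order. *)
Definition adjacency_lists (n : nat) (e : rel 'I_n) (adj : 'I_n -> seq 'I_n) :=
  forall v, uniq (adj v) /\ adj v =i e v.

(* Memory layout: n, m, k, then n + 1 offsets, then the concatenated adjacency *)
(* lists; the list of v occupies positions offset v to offset (v + 1) - 1 of   *)
(* the last block.                                                             *)
Definition graph_input (n : nat) (e : rel 'I_n) (adj : 'I_n -> seq 'I_n)
    (k : nat) : seq nat :=
  let lists := [seq [seq val u | u <- adj v] | v <- enum 'I_n] in
  [:: n; #|edge_set e|; k]
    ++ [seq sumn (take i (shape lists)) | i <- iota 0 n.+1]
    ++ flatten lists.

(* Main.v *)
Require Import Defs.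
From mathcomp Require Import all_boot all_order all_algebra.
From mathcomp Require Import zify ring.
From mathcomp Require Import reals exp.

Set Implicit Arguments.
Unset Strict Implicit.
Unset Printing Implicit Defensive.

(* For a set U of vertices let far U x be the largest distance from U to x.   *)
(* Its minimum over x never exceeds the radius rho. By the Helly property     *)
(* there is a set B of at most k vertices such that no ball of radius rho - 1 *)
(* contains B. Choose x minimizing far U; if far U x < rho, then some vertex  *)
(* of B lies at distance more than far U x from x, so adding to U all such    *)
(* violators of x adds a new vertex of B. After at most k such rounds B is    *)
(* contained in U, and then the minimum of far U is rho. The answer is thus   *)
(* always right, and randomness only controls the time: U starts as a sample  *)
(* of about sqrt (k n) log n vertices, so that with high probability the      *)
(* violators number at most sqrt (n / k) in each round, and the algorithm     *)
(* performs about sqrt (k n) log n breadth-first searches in total, with      *)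
(* min (k, n) in place of k. With fewer than n / 2 edges some vertex is       *)
(* isolated and the answer n (infinity) is immediate; otherwise a search      *)
(* takes O(m) time.                                                           *)

(** * Timed execution of programs *)

(** Correctness. Distances to unreachable vertices count as n, so the radius rho is at most n. If
    rho > 0, no vertex lies in all balls of radius rho - 1; by the Helly property at most k of these
    balls already have empty intersection, and their centers form B: every x is at distance at least
    rho from some vertex of B ([k_helly_witness]). A minimizer x of [far U] satisfies far U x <=
    rho. If the inequality is strict, the vertex of B far from x is a violator outside U, so the
    round shrinks the part of B missing from U ([rounds_inv_step]); with k' = min (k, n), k' + 1
    rounds end with the value rho ([rounds_spec]).

    Time. Let q be sqrt (k' n) rounded up and 2^L the power of two with n <= 2^L < 2 n. Call the
    initial sample spread if every ball containing it leaves at most n / q vertices outside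
    ([spread]); then each round inserts at most n / q violators. A set of more than n / q vertices
    is missed by 2 q draws with probability at most 1/2 ([half_expn]), hence by all 6 q L draws with
    probability at most 2^(-3 L) <= n^(-3) ([card_misses]). Only n^2 balls matter, so the sample is
    spread with probability at least 1 - 1/n ([card_not_spreads]). In that case there are O(q L)
    searches, each linear in the input ([bfs_spec]), and [radius_prog_spec] with [radius_time] gives
    O(q L m) steps when the total degree is at least n; otherwise some vertex is isolated
    ([tot_deg_sparse]).

    Programs are verified in a big-step semantics with running times, which [iter_step_runs]
    transfers to the machine; probabilities are counts of coin sequences of length T. *)

Section Logic.
Variable w : nat.

Inductive runs : cmd -> state -> nat -> state -> Prop :=
| runs_const x a s : runs (Const x a) s 1 (set_reg w s x a)
| runs_binop o x y z s : runs (Binop o x y z) s 1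
    (set_reg w s x (eval_binop o (regs s y) (regs s z)))
| runs_read x y s : runs (Read x y) s 1 (set_reg w s x (memory s (regs s y)))
| runs_write x y s : runs (Write x y) s 1
    (State (regs s) (upd (memory s) (regs s x) (regs s y)) (coins s))
| runs_flip x s : runs (Flip x) s 1
    (set_reg w (State (regs s) (memory s) (behead (coins s)))
       x (head false (coins s)))
| runs_seq c1 c2 s t1 s1 t2 s2 :
    runs c1 s t1 s1 -> runs c2 s1 t2 s2 -> runs (Seq c1 c2) s (t1 + t2).+1 s2
| runs_if x c1 c2 s t s' :
    runs (if regs s x != 0 then c1 else c2) s t s' ->
    runs (If x c1 c2) s t.+1 s'
| runs_while0 x c s : regs s x = 0 -> runs (While x c) s 1 s
| runs_whileS x c s t1 s1 t2 s2 : regs s x != 0 -> runs c s t1 s1 ->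
    runs (While x c) s1 t2 s2 -> runs (While x c) s (t1 + t2).+1 s2.

(** The stack [K] is arbitrary so that the induction can chain the two halves of a sequence or of a
    loop iteration. *)
Lemma iter_step_runs c s t s' : runs c s t s' ->
  forall K, iter t (step w) (c :: K, s) = (K, s').
Proof.
elim=> {c s t s'} //.
- move=> c1 c2 s t1 s1 t2 s2 _ IH1 _ IH2 K.
  by rewrite iterSr addnC iterD /= IH1 IH2.
- by move=> x c1 c2 s t s' _ IH K; rewrite iterSr /= IH.
- by move=> x c s x0 K; rewrite /= /step /= x0.
- move=> x c s t1 s1 t2 s2 x0 _ IH1 _ IH2 K.
  by rewrite iterSr addnC iterD /step /= x0 IH1 IH2.
Qed.

Fixpoint written (c : cmd) : seq nat :=
  match c with
  | Const x _ | Binop _ x _ _ | Read x _ | Flip x => [:: x]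
  | Write _ _ => [::]
  | Seq c1 c2 | If _ c1 c2 => written c1 ++ written c2
  | While _ c1 => written c1
  end.

Fixpoint flip_free (c : cmd) : bool :=
  match c with
  | Flip _ => false
  | Seq c1 c2 | If _ c1 c2 => flip_free c1 && flip_free c2
  | While _ c1 => flip_free c1
  | _ => true
  end.

Fixpoint write_free (c : cmd) : bool :=
  match c with
  | Write _ _ => false
  | Seq c1 c2 | If _ c1 c2 => write_free c1 && write_free c2
  | While _ c1 => write_free c1
  | _ => true
  end.

(** Syntactic frame rule: specifications then need to mention only what changes. *)
Lemma runs_frame c s t s' : runs c s t s' ->
  [/\ forall i, i \notin written c -> regs s' i = regs s i,
      flip_free c -> coins s' = coins s
    & write_free c -> memory s' = memory s].
Proof.
have upd_notin f x a i : i \notin [:: x] -> upd f x a i = f i.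
  by rewrite inE /upd => /negPf ->.
elim=> {c s t s'}; try by move=> *; split=> //= *; exact: upd_notin.
- move=> c1 c2 s t1 s1 t2 s2 _ [r1 k1 m1] _ [r2 k2 m2] /=; split.
  + by move=> i; rewrite mem_cat negb_or => /andP[i1 i2]; rewrite r2 ?r1.
  + by case/andP=> f1 f2; rewrite k2 ?k1.
  + by case/andP=> f1 f2; rewrite m2 ?m1.
- move=> x c1 c2 s t s' _ [r k m] /=; split.
  + move=> i; rewrite mem_cat negb_or => /andP[i1 i2]; apply: r.
    by case: ifP.
  + by case/andP=> f1 f2; apply: k; case: ifP.
  + by case/andP=> f1 f2; apply: m; case: ifP.
- move=> x c s t1 s1 t2 s2 _ _ [r1 k1 m1] _ [r2 k2 m2] /=; split=> [i ic|fc|fc].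
  + by rewrite r2 ?r1.
  + by rewrite k2 ?k1.
  + by rewrite m2 ?m1.
Qed.

(** Total correctness with a time bound. The machine is deterministic once the coins are fixed, so
    exhibiting one run suffices. *)
Definition spec (c : cmd) (s : state) (T : nat) (Q : state -> Prop) :=
  exists t s', [/\ t <= T, runs c s t s' & Q s'].

Lemma spec_conseq c s T (Q Q' : state -> Prop) T' :
  spec c s T Q -> T <= T' -> (forall s', Q s' -> Q' s') -> spec c s T' Q'.
Proof.
move=> [t [s' [tT r q]]] TT' QQ'; exists t, s'; split=> //; last exact: QQ'.
exact: leq_trans TT'.
Qed.

Lemma spec_frame c s T (Q : state -> Prop) : spec c s T Q ->
  spec c s T (fun s' => [/\ Q s',
      forall i, i \notin written c -> regs s' i = regs s i,
      flip_free c -> coins s' = coins s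
    & write_free c -> memory s' = memory s]).
Proof.
move=> [t [s' [tT r q]]]; exists t, s'; split=> //.
by case: (runs_frame r).
Qed.

Lemma spec_seq T1 T2 c1 c2 s T Q :
  spec c1 s T1 (fun s1 => spec c2 s1 T2 Q) -> T1 + T2 < T ->
  spec (Seq c1 c2) s T Q.
Proof.
move=> [t1 [s1 [t1T r1 [t2 [s2 [t2T r2 q]]]]]] TT.
exists (t1 + t2).+1, s2; split=> //; [lia | exact: runs_seq r1 r2].
Qed.

Lemma spec_if x c1 c2 s T (Q : state -> Prop) :
  (regs s x != 0 -> spec c1 s T Q) -> (regs s x = 0 -> spec c2 s T Q) ->
  spec (If x c1 c2) s T.+1 Q.
Proof.
move=> h1 h2.
suff [t [s' [tT r q]]] : spec (if regs s x != 0 then c1 else c2) s T Q.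
  by exists t.+1, s'; split=> //; exact: runs_if.
by case: (eqVneq (regs s x) 0) => /=.
Qed.

(* The potential t both bounds the remaining time and ensures termination. *)
Lemma spec_while (P : nat -> state -> Prop) x c t s T (Q : state -> Prop) :
  (forall t s, P t s -> regs s x != 0 ->
     exists t1 t2, spec c s t1 (P t2) /\ t1 + t2 < t) ->
  (forall t s, P t s -> regs s x = 0 -> Q s) ->
  P t s -> t < T -> spec (While x c) s T Q.
Proof.
move=> body done Pts tT; apply: spec_conseq (_ : spec _ s t.+1 Q) tT _ => // {T}.
elim/ltn_ind: t s Pts => t IH s Pts.
case: (eqVneq (regs s x) 0) => x0.
  by exists 1, s; split=> //; [exact: runs_while0 | exact: done Pts x0].
have [t1 [t2 [[t1' [s1 [t1t r1 P1]]] tt]]] := body _ _ Pts x0.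
have [|t3 [s3 [t3t r3 q]]] := IH t2 _ s1 P1; first lia.
exists (t1' + t3).+1, s3; split=> //; [lia | exact: runs_whileS r1 r3].
Qed.

(** The counter descends and [I i] holds with i iterations left. The bound [tb] may vary, for loops
    in which only some iterations are expensive. *)
Lemma spec_for_sum (tb : nat -> nat) (I : nat -> state -> Prop) N x c s T
    (Q : state -> Prop) :
  (forall i s, i < N -> regs s x = i.+1 -> I i.+1 s ->
     spec c s (tb i) (fun s' => regs s' x = i /\ I i s')) ->
  regs s x = N -> I N s -> (forall s', I 0 s' -> Q s') ->
  \sum_(i < N) (tb i).+1 < T -> spec (While x c) s T Q.
Proof.
move=> body xN IN Q0.
pose P t s := [/\ regs s x <= N, I (regs s x) s &
   t = \sum_(i < regs s x) (tb i).+1].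
apply: (spec_while (P := P)).
- move=> t s1 [rN Is ->]; case E : (regs s1 x) => [//|i] _.
  rewrite E in rN Is; exists (tb i), (\sum_(j < i) (tb j).+1).
  split; last by rewrite big_ord_recr /=; lia.
  apply: spec_conseq (body i s1 rN E Is) _ _ => // s2 [E2 I2].
  by split; rewrite E2 //; exact: ltnW.
- by move=> t s1 [_ Is _] E; rewrite E in Is; exact: Q0.
- by split; rewrite xN.
Qed.

Lemma spec_for tb (I : nat -> state -> Prop) N x c s T (Q : state -> Prop) :
  (forall i s, i < N -> regs s x = i.+1 -> I i.+1 s ->
     spec c s tb (fun s' => regs s' x = i /\ I i s')) ->
  regs s x = N -> I N s -> (forall s', I 0 s' -> Q s') ->
  N * tb.+1 < T -> spec (While x c) s T Q.
Proof.
move=> body xN IN Q0 NT; apply: (spec_for_sum (tb := fun=> tb) body xN IN Q0).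
by rewrite sum_nat_const card_ord.
Qed.

(* Weakest precondition of loop-free code; it requires that no operation     *)
(* overflows, so that the reductions modulo 2 ^ w disappear. Computed values  *)
(* are named by quantifiers: substituting them would blow up exponentially.   *)
Fixpoint wp (c : cmd) (Q : (nat -> nat) -> (nat -> nat) -> seq bool -> Prop)
    (r m : nat -> nat) (k : seq bool) : Prop :=
  match c with
  | Const x a => a < 2 ^ w /\ Q (upd r x a) m k
  | Binop o x y z => forall v, v = eval_binop o (r y) (r z) ->
      v < 2 ^ w /\ Q (upd r x v) m k
  | Read x y => forall v, v = m (r y) -> v < 2 ^ w /\ Q (upd r x v) m k
  | Write x y => Q r (upd m (r x) (r y)) k
  | Flip x => 1 < 2 ^ w /\ Q (upd r x (head false k)) m (behead k)
  | Seq c1 c2 => wp c1 (wp c2 Q) r m k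
  | If x c1 c2 => if r x != 0 then wp c1 Q r m k else wp c2 Q r m k
  | While _ _ => False
  end.

Fixpoint cost (c : cmd) : nat :=
  match c with
  | Seq c1 c2 | If _ c1 c2 => (cost c1 + cost c2).+1
  | _ => 1
  end.

Lemma spec_wp_cost c r m k Q :
  wp c (fun r m k => Q (State r m k)) r m k -> spec c (State r m k) (cost c) Q.
Proof.
suff H : forall Q, wp c Q r m k ->
    spec c (State r m k) (cost c) (fun s => Q (regs s) (memory s) (coins s)).
  by move=> /H h; apply: spec_conseq h _ _ => // -[].
move=> {}Q; have small s1 x a : a < 2 ^ w -> set_reg w s1 x a =
    State (upd (regs s1) x a) (memory s1) (coins s1).
  by move=> aw; rewrite /set_reg modn_small.
elim: c Q r m k => [x a|o x y z|x y|x y|x|c1 IH1 c2 IH2|x c1 IH1 c2 IH2|//]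
  Q r m k /=.
- case=> aw qq; exists 1; eexists; split; [by []|exact: runs_const|].
  by rewrite small.
- case/(_ _ erefl)=> aw qq; exists 1; eexists; split; [by []|exact: runs_binop|].
  by rewrite small.
- case/(_ _ erefl)=> aw qq; exists 1; eexists; split; [by []|exact: runs_read|].
  by rewrite small.
- by move=> qq; exists 1; eexists; split; [by []|exact: runs_write|].
- case=> aw qq; exists 1; eexists; split; [by []|exact: runs_flip|].
  by rewrite small //=; case: (head _ _) => //; exact: ltnW.
- move=> /IH1 h; apply: (spec_seq (T1 := cost c1) (T2 := cost c2)) => //.
  by apply: spec_conseq h _ _ => // -[r' m' k'] /IH2.
- move=> h; apply: spec_if => /= x0.
    rewrite x0 in h; apply: spec_conseq (IH1 _ _ _ _ h) _ _ => //; exact: leq_addr.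
  rewrite x0 /= in h; apply: spec_conseq (IH2 _ _ _ _ h) _ _ => //; exact: leq_addl.
Qed.

Lemma spec_wp c s T Q :
  wp c (fun r m k => Q (State r m k)) (regs s) (memory s) (coins s) ->
  cost c <= T -> spec c s T Q.
Proof. by case: s => r m k W cT; apply: spec_conseq (spec_wp_cost W) cT _. Qed.

End Logic.

(** * Distances and breadth-first search *)

Section Distance.
Variables (T : finType) (e : rel T).
Local Notation dist := (graph_dist e).

Lemma graph_dist_le_card u v : dist u v <= #|T|.
Proof. by rewrite /graph_dist -[X in _ <= X](size_iota 0) find_size. Qed.

Lemma graph_dist_le_path u p : path e u p -> dist u (last u p) <= size p.
Proof.
case/shortenP=> q pq uq /uniq_leq_size; rewrite (subseq_uniq _ uq) ?subseq_cons //.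
move=> /(_ isT) qp; apply: leq_trans qp.
rewrite leqNgt; apply/negP => lt_find.
have qT : size q < #|T|.
  by rewrite -[(size q).+1]/(size (u :: q)) -(card_uniqP uq) max_card.
have := before_find 0 lt_find; rewrite nth_iota // add0n => /existsP; apply.
by exists (in_tuple q); rewrite pq eqxx.
Qed.

Lemma graph_dist_path u v : dist u v < #|T| ->
  exists p, [/\ path e u p, last u p = v & size p = dist u v].
Proof.
rewrite /graph_dist => lt_find.
have := nth_find 0 (_ : has (has_path_of_length e u v) (iota 0 #|T|)).
rewrite has_find size_iota => /(_ lt_find); rewrite nth_iota // add0n.
case/existsP=> p /and3P[pp /eqP lp _]; exists p; split=> //.
exact: size_tuple.
Qed.

Lemma graph_dist_sym : symmetric e -> forall u v, dist u v = dist v u.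
Proof.
move=> es; suff le u v : dist u v <= dist v u.
  by move=> u v; apply/eqP; rewrite eqn_leq !le.
have [/graph_dist_path [p [pp <- <-]]|] := ltnP (dist v u) #|T|; last first.
  by apply: leq_trans; exact: graph_dist_le_card.
have E : last (last v p) (rev (belast v p)) = v.
  by case: p {pp} => //= x p; rewrite rev_cons last_rcons.
rewrite -[X in dist _ X]E -(size_belast v p) -size_rev.
apply: graph_dist_le_path.
by rewrite rev_path; apply: sub_path pp => x y; rewrite es.
Qed.

End Distance.

(** * The invariant of breadth-first search *)

Section BreadthFirstSearch.
Variables (n : nat) (e : rel 'I_n) (u : 'I_n).

(* Q is the list of discovered vertices, of which the first h are processed;  *)
(* D v = n stands for an undiscovered vertex.                                 *)
Record bfs_inv (Q : seq 'I_n) (h : nat) (D : 'I_n -> nat) : Prop := BfsInv {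
  bfs_uniq : uniq Q;
  bfs_source : u \in Q;
  bfs_source0 : D u = 0;
  bfs_out : forall v, v \notin Q -> D v = n;
  bfs_index : forall v, v \in Q -> D v <= index v Q;
  bfs_sorted : forall v x, v \in Q -> x \in Q -> index v Q <= index x Q ->
    D v <= D x;
  bfs_window : forall v x, v \in Q -> x \in Q -> h <= index x Q ->
    D v <= (D x).+1;
  bfs_path : forall v, v \in Q ->
    exists p, [/\ path e u p, last u p = v & size p = D v];
  bfs_closed : forall v y, v \in Q -> index v Q < h -> e v y -> D y <= (D v).+1
}.

Lemma bfs_size Q h D : bfs_inv Q h D -> size Q <= n.
Proof.
by move/bfs_uniq/card_uniqP => <-; rewrite -[X in _ <= X]card_ord max_card.
Qed.

(** A discovered vertex has a label at most its queue position, hence below n, so the mark n for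
    undiscovered vertices is unambiguous. *)
Lemma bfs_lt Q h D v : bfs_inv Q h D -> (D v < n) = (v \in Q).
Proof.
move=> I; case: (boolP (v \in Q)) => vQ; last by rewrite (bfs_out I vQ) ltnn.
apply: leq_ltn_trans (bfs_index I vQ) _; apply: leq_trans (bfs_size I).
by rewrite index_mem.
Qed.

Lemma bfs_init : bfs_inv [:: u] 0 (fun v => if v == u then 0 else n).
Proof.
split; rewrite ?inE ?eqxx //.
- by move=> v; rewrite inE => /negPf ->.
- by move=> v; rewrite inE => ->.
- by move=> v x; rewrite !inE => /eqP -> /eqP ->.
- by move=> v x; rewrite !inE => /eqP -> /eqP ->; rewrite leqnSn.
- by move=> v; rewrite inE => /eqP ->; exists [::]; rewrite eqxx.
Qed.

(** The new label is one more than that of the head. By [bfs_window] no queued label exceeds it, so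
    the queue stays sorted; as the head has the least unprocessed label, the window property
    survives too. *)
Lemma bfs_discover Q h D y : bfs_inv Q h D -> h < size Q -> y \notin Q ->
  e (nth u Q h) y ->
  bfs_inv (rcons Q y) h (fun v => if v == y then (D (nth u Q h)).+1 else D v).
Proof.
move=> I hQ yQ ey; set x := nth u Q h.
have xQ : x \in Q by exact: mem_nth.
have ix : index x Q = h by rewrite index_uniq // (bfs_uniq I).
have idx v : v \in Q -> index v (rcons Q y) = index v Q.
  by move=> vQ; rewrite -cats1 index_cat vQ.
have idy : index y (rcons Q y) = size Q.
  by rewrite -cats1 index_cat (negPf yQ) /= eqxx addn0.
have neq v : v \in Q -> (v == y) = false.
  by move=> vQ; apply: contraNF yQ => /eqP <-.
have lt v : v \in Q -> index v Q < size Q by rewrite index_mem.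
split.
- by rewrite rcons_uniq yQ (bfs_uniq I).
- by rewrite mem_rcons inE (bfs_source I) orbT.
- by rewrite neq (bfs_source0 I, bfs_source I).
- by move=> v; rewrite mem_rcons inE negb_or => /andP[/negPf -> /(bfs_out I)].
- move=> v; rewrite mem_rcons inE => /orP[/eqP -> | vQ].
    by rewrite eqxx idy; have := bfs_index I xQ; rewrite ix; lia.
  by rewrite neq // idx // (bfs_index I vQ).
- move=> v z; rewrite !mem_rcons !inE.
  move=> /orP[/eqP -> | vQ] /orP[/eqP -> | zQ]; rewrite ?eqxx ?neq ?idy ?idx //.
  + by have := lt _ zQ; lia.
  + by move=> _; apply: (bfs_window I) => //; rewrite ix.
  + exact: (bfs_sorted I).
- move=> v z; rewrite !mem_rcons !inE.
  move=> /orP[/eqP -> | vQ] /orP[/eqP -> | zQ]; rewrite ?eqxx ?neq ?idy ?idx //.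
  + by move=> hz; rewrite ltnS; apply: (bfs_sorted I); rewrite ?ix.
  + by move=> _; apply: leqW; apply: (bfs_window I) => //; rewrite ix.
  + exact: (bfs_window I).
- move=> v; rewrite mem_rcons inE => /orP[/eqP -> | vQ]; last first.
    by rewrite neq //; exact: (bfs_path I).
  have [p [pp lp sp]] := bfs_path I xQ; exists (rcons p y).
  by rewrite rcons_path pp lp ey last_rcons size_rcons sp eqxx.
- move=> v z; rewrite mem_rcons inE => /orP[/eqP -> | vQ].
    by rewrite idy; lia.
  rewrite idx // (neq v) // => vh ez; apply: leq_trans (bfs_closed I vQ vh ez).
  (* The label of [y] only drops, from n, so edges leaving processed vertices stay closed. *)
  case: eqP => [->|//]; rewrite (bfs_out I yQ).
  have := bfs_index I xQ; rewrite ix; have := bfs_size I; lia.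
Qed.

Lemma bfs_advance Q h D : bfs_inv Q h D -> h < size Q ->
  (forall y, e (nth u Q h) y -> D y <= (D (nth u Q h)).+1) ->
  bfs_inv Q h.+1 D.
Proof.
move=> I hQ cl; split; try by case: I.
- by move=> v x vQ xQ hx; apply: (bfs_window I) => //; exact: ltnW.
- move=> v y vQ; rewrite ltnS leq_eqVlt => /orP[/eqP E|vh]; last first.
    exact: (bfs_closed I).
  by have := cl y; rewrite -E nth_index.
Qed.

(** With the queue exhausted, labels grow by at most one along each edge, hence are at most the
    distances; the paths of [bfs_path] give the converse. *)
Lemma bfs_final Q h D : bfs_inv Q h D -> size Q <= h -> D =1 graph_dist e u.
Proof.
move=> I hQ v.
have closed x y : D x < n -> e x y -> D y <= (D x).+1.
  rewrite (bfs_lt _ I) => xQ exy; apply: (bfs_closed I) => //.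
  by apply: leq_trans hQ; rewrite index_mem.
have Dle p : path e u p -> size p < n -> D (last u p) <= size p.
  elim/last_ind: p => [|p y IH]; first by rewrite /= (bfs_source0 I).
  rewrite rcons_path last_rcons size_rcons => /andP[pp ey] sp.
  have le := IH pp (ltnW sp); apply: leq_trans (closed _ _ _ ey) _ => //.
  exact: leq_ltn_trans (ltnW sp).
have Dn : D v <= n.
  case: (boolP (v \in Q)) => [|/(bfs_out I) -> //].
  by rewrite -(bfs_lt _ I) => /ltnW.
have := @graph_dist_le_card _ e u v; rewrite card_ord => dn.
apply/eqP; rewrite eqn_leq; apply/andP; split.
  have [lt|] := ltnP (graph_dist e u v) n; last exact: leq_trans.
  have [|p [pp lp sp]] := @graph_dist_path _ e u v; first by rewrite card_ord.
  by rewrite -sp -lp; apply: Dle => //; rewrite sp.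
case: (boolP (v \in Q)) => [vQ|/(bfs_out I) -> //].
have [p [pp <- <-]] := bfs_path I vQ; exact: graph_dist_le_path.
Qed.

End BreadthFirstSearch.

(** * The program *)

Notation "c1 ;; c2" := (Seq c1 c2)
  (at level 70, right associativity, only parsing).

(* r_d, r_queue, r_f and r_d' hold the base addresses of four arrays of       *)
(* length n stored behind the input: the distances computed by an update, the *)
(* queue, the function far, and the distances from the current candidate      *)
(* center. A search fills the distance array whose base is in r_db.           *)
Local Notation r_one := 1 (only parsing).
Local Notation r_n := 2 (only parsing).
Local Notation r_three := 3 (only parsing).
Local Notation r_adj := 4 (only parsing).
Local Notation r_d := 5 (only parsing).
Local Notation r_queue := 6 (only parsing).
Local Notation r_f := 7 (only parsing).
Local Notation r_d' := 8 (only parsing).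
Local Notation r_k := 9 (only parsing).
Local Notation r_zero := 10 (only parsing).
Local Notation r_tot := 11 (only parsing).
Local Notation r_q := 12 (only parsing).
Local Notation r_bits := 13 (only parsing).
Local Notation r_src := 20 (only parsing).
Local Notation r_db := 21 (only parsing).
Local Notation r_i := 22 (only parsing).
Local Notation r_t := 23 (only parsing).
Local Notation r_head := 24 (only parsing).
Local Notation r_tail := 25 (only parsing).
Local Notation r_v := 26 (only parsing).
Local Notation r_dv := 27 (only parsing).
Local Notation r_cnt := 28 (only parsing).
Local Notation r_ptr := 29 (only parsing).
Local Notation r_y := 30 (only parsing).
Local Notation r_dy := 31 (only parsing).
Local Notation r_c := 32 (only parsing).
Local Notation r_g := 33 (only parsing).

Local Notation r_samples := 34 (only parsing).
Local Notation r_cell := 35 (only parsing).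
Local Notation r_rounds := 36 (only parsing).
Local Notation r_out := 0 (only parsing).

Definition bfs_fill :=
  Binop OpSub r_i r_i r_one ;; Binop OpAdd r_t r_db r_i ;; Write r_t r_n.

Definition bfs_start :=
  Binop OpAdd r_t r_db r_src ;; Write r_t r_zero ;; Write r_queue r_src ;;
  Const r_head 0 ;; Const r_tail 1 ;; Const r_g 1.

Definition bfs_pop :=
  Binop OpAdd r_t r_queue r_head ;; Read r_v r_t ;;
  Binop OpAdd r_head r_head r_one ;;
  Binop OpAdd r_t r_db r_v ;; Read r_dv r_t ;; Binop OpAdd r_dv r_dv r_one ;;
  Binop OpAdd r_t r_three r_v ;; Read r_ptr r_t ;;
  Binop OpAdd r_t r_t r_one ;; Read r_cnt r_t ;;
  Binop OpSub r_cnt r_cnt r_ptr ;; Binop OpAdd r_ptr r_ptr r_adj.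

Definition bfs_scan :=
  Binop OpSub r_cnt r_cnt r_one ;;
  Read r_y r_ptr ;; Binop OpAdd r_ptr r_ptr r_one ;;
  Binop OpAdd r_t r_db r_y ;; Read r_dy r_t ;; Binop OpEq r_c r_dy r_n ;;
  If r_c (Write r_t r_dv ;; Binop OpAdd r_t r_queue r_tail ;; Write r_t r_y ;;
          Binop OpAdd r_tail r_tail r_one)
         (Const r_c 0).

Definition bfs_visit :=
  bfs_pop ;; While r_cnt bfs_scan ;; Binop OpLt r_g r_head r_tail.

Definition bfs :=
  Binop OpAdd r_i r_n r_zero ;; While r_i bfs_fill ;; bfs_start ;;
  While r_g bfs_visit.

Definition update_cell :=
  Binop OpSub r_i r_i r_one ;; Binop OpAdd r_t r_d r_i ;; Read r_dy r_t ;;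
  Binop OpAdd r_t r_f r_i ;; Read r_y r_t ;; Binop OpLt r_g r_y r_dy ;;
  If r_g (Write r_t r_dy) (Const r_g 0).

Definition update :=
  Binop OpAdd r_db r_d r_zero ;; bfs ;; Binop OpAdd r_i r_n r_zero ;;
  While r_i update_cell.

Definition sample_bit :=
  Binop OpSub r_cnt r_cnt r_one ;; Flip r_c ;;
  Binop OpAdd r_src r_src r_src ;; Binop OpAdd r_src r_src r_c.

Definition sample_step :=
  Binop OpSub r_samples r_samples r_one ;;
  Const r_src 0 ;; Binop OpAdd r_cnt r_bits r_zero ;; While r_cnt sample_bit ;;
  Binop OpMod r_src r_src r_n ;; update.

Definition argmin_cell :=
  Binop OpSub r_cell r_cell r_one ;; Binop OpAdd r_t r_f r_cell ;;
  Read r_dy r_t ;; Binop OpLt r_g r_dy r_out ;;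
  If r_g (Binop OpAdd r_out r_dy r_zero ;; Binop OpAdd r_src r_cell r_zero)
         (Const r_g 0).

Definition argmin :=
  Const r_src 0 ;; Read r_out r_f ;; Binop OpAdd r_cell r_n r_zero ;;
  While r_cell argmin_cell.

Definition violator_cell :=
  Binop OpSub r_cell r_cell r_one ;; Binop OpAdd r_t r_d' r_cell ;;
  Read r_dy r_t ;; Binop OpLt r_g r_out r_dy ;;
  If r_g (Binop OpAdd r_src r_cell r_zero ;; update) (Const r_g 0).

Definition round :=
  Binop OpSub r_rounds r_rounds r_one ;; argmin ;;
  Binop OpAdd r_db r_d' r_zero ;; bfs ;;
  Binop OpAdd r_cell r_n r_zero ;; While r_cell violator_cell.

Definition setup :=
  Const r_one 1 ;; Const r_zero 0 ;; Const r_three 3 ;; Read r_n r_zero ;;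
  Binop OpAdd r_t r_three r_n ;; Read r_tot r_t ;; Binop OpLt r_g r_tot r_n.

Definition layout :=
  Const r_k 2 ;; Read r_k r_k ;; Binop OpAdd r_adj r_t r_one ;;
  Binop OpAdd r_d r_adj r_tot ;; Binop OpAdd r_queue r_d r_n ;;
  Binop OpAdd r_f r_queue r_n ;; Binop OpAdd r_d' r_f r_n ;;
  Binop OpLt r_g r_k r_n ;;
  If r_g (Const r_g 0) (Binop OpAdd r_k r_n r_zero).

Definition sqrt_start :=
  Binop OpMul r_y r_k r_n ;; Const r_q 0 ;; Const r_g 1.

Definition sqrt_step :=
  Binop OpAdd r_q r_q r_one ;; Binop OpMul r_t r_q r_q ;; Binop OpLt r_g r_t r_y.

Definition log_start :=
  Const r_bits 0 ;; Const r_t 1 ;; Binop OpLt r_g r_t r_n.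

Definition log_step :=
  Binop OpAdd r_bits r_bits r_one ;; Binop OpAdd r_t r_t r_t ;;
  Binop OpLt r_g r_t r_n.

Definition sample_start :=
  Const r_samples 6 ;; Binop OpMul r_samples r_samples r_q ;;
  Binop OpMul r_samples r_samples r_bits.

Definition radius_main :=
  layout ;; sqrt_start ;; While r_g sqrt_step ;;
  log_start ;; While r_g log_step ;;
  sample_start ;; While r_samples sample_step ;;
  Binop OpAdd r_rounds r_k r_one ;; While r_rounds round.

Definition radius_prog :=
  setup ;; If r_g (Binop OpAdd r_out r_n r_zero) radius_main.

Ltac wp_step E := move=> ? ->; rewrite ?E; split; [lia|].

(* M0 is the initial memory and tot the total length of the adjacency lists.  *)
Section Program.
Variables (n : nat) (e : rel 'I_n) (adj : 'I_n -> seq 'I_n) (w : nat).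
Variables (M0 : nat -> nat) (tot : nat).
Hypothesis offS : forall v : 'I_n, M0 (3 + v + 1) = M0 (3 + v) + size (adj v).
Hypothesis adj_mem : forall (v : 'I_n) j, j < size (adj v) ->
  M0 (M0 (3 + v) + (4 + n) + j) = nth v (adj v) j.
Hypothesis off_le : forall v : 'I_n, M0 (3 + v) + size (adj v) <= tot.
Hypothesis tot_sum : \sum_(v : 'I_n) size (adj v) = tot.
Hypothesis adjE : forall v, adj v =i e v.
Hypothesis w_large : 20 + 20 * n + tot < 2 ^ w.

Local Notation B0 := (4 + n + tot).

Definition consts (s : state) : Prop :=
  [/\ regs s r_one = 1, regs s r_n = n, regs s r_three = 3,
      regs s r_adj = 4 + n
    & [/\ regs s r_d = B0, regs s r_queue = B0 + n, regs s r_f = B0 + n + n,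
          regs s r_d' = B0 + n + n + n & regs s r_zero = 0]].

Lemma consts_frame s s' :
  (forall i, 0 < i < 20 -> regs s' i = regs s i) -> consts s -> consts s'.
Proof. by move=> E; rewrite /consts !E. Qed.

(** * Breadth-first search on the machine *)

Section Bfs.
Variables (u : 'I_n) (db : nat) (m0 : nat -> nat).
(** The array is the one at [r_d] or the one at [r_d']; both avoid the input and the queue. *)
Hypothesis dbE : db = B0 \/ db = B0 + n + n + n.
Hypothesis m0E : forall a, a < B0 -> m0 a = M0 a.

Definition bfs_outside (s : state) :=
  forall a, a < db \/ db + n <= a -> a < B0 + n \/ B0 + n + n <= a ->
    memory s a = m0 a.

Record bfs_state (Q : seq 'I_n) (D : 'I_n -> nat) (s : state) : Prop := {
  bfs_consts : consts s;
  bfs_db : regs s r_db = db;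
  bfs_tail : regs s r_tail = size Q;
  bfs_D : forall v : 'I_n, memory s (db + v) = D v;
  bfs_Q : forall i, i < size Q -> memory s (B0 + n + i) = nth u Q i;
  bfs_mem : bfs_outside s
}.

(** Here [i] neighbours of [x] remain to be scanned. [P] freezes the queue up to [x], which
    discoveries do not alter; the potential after the visit is computed from it. *)
Record scanned (x : 'I_n) (dx h : nat) (P : seq 'I_n) (i : nat) (s : state)
    (Q : seq 'I_n) (D : 'I_n -> nat) : Prop := Scanned {
  scan_le : i <= size (adj x);
  scan_bfs : bfs_inv e u Q h D;
  scan_lt : h < size Q;
  scan_x : nth u Q h = x;
  scan_P : take h.+1 Q = P;
  scan_dx : D x = dx;
  scan_state : bfs_state Q D s;
  scan_head : regs s r_head = h.+1;
  scan_dv : regs s r_dv = dx.+1;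
  scan_ptr : regs s r_ptr = M0 (3 + x) + (4 + n) + (size (adj x) - i);
  scan_done : forall y, y \in take (size (adj x) - i) (adj x) -> D y <= dx.+1
}.

Definition scan_inv x dx h P i s := exists Q D, scanned x dx h P i s Q D.

Lemma bfs_scan_spec x dx h P i s : regs s r_cnt = i.+1 ->
  scan_inv x dx h P i.+1 s ->
  spec w bfs_scan s 30 (fun s' => regs s' r_cnt = i /\ scan_inv x dx h P i s').
Proof.
move=> Ei [Q [D [ilt I hQ xE PE dxE S Eh Edv Eptr done]]].
case: (S) => [[E1 E2 E3 E4 [E5 E6 E7 E8 E10]] Edb Et DE QE ME].
set j := size (adj x) - i.+1 in Eptr done.
have jlt : j < size (adj x) by lia.
set y := nth x (adj x) j.
have Ey : memory s (M0 (3 + x) + (4 + n) + j) = y.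
  rewrite ME ?m0E ?adj_mem //; have := off_le x; lia.
have exy : e x y by have := adjE x y; rewrite mem_nth.
have yn := ltn_ord y.
have takeS : take (size (adj x) - i) (adj x) = rcons (take j (adj x)) y.
  by rewrite -(take_nth x jlt); congr take; lia.
have Qn := bfs_size I.
have off := off_le x.
apply: spec_wp; last by [].
rewrite /= /upd /= Ei E1 Eptr Edb E2 E6 Et.
have Dy : D y <= n.
  case: (boolP (y \in Q)) => [|/(bfs_out I) -> //].
  by rewrite -(bfs_lt _ I) => /ltnW.
have Dyn : (D y == n) = (y \notin Q).
  rewrite -(bfs_lt _ I); lia.
have b2 : nat_of_bool (D y == n) < 2 ^ w by lia.
have hD : D x <= h.
  have xQ : x \in Q by rewrite -xE mem_nth.
  have := bfs_index I xQ; by rewrite -xE index_uniq // (bfs_uniq I).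
do 6! wp_step (Ey, DE); rewrite Dyn.
have [yQ|yQ] := boolP (y \in Q); rewrite /=.
  do 2! [split; first lia].
  exists Q, D; split=> //=; try lia.
  move=> z; rewrite takeS mem_rcons inE => /orP[/eqP -> {z}|]; last exact: done.
  rewrite -dxE; apply: (bfs_window I) => //; first by rewrite -xE mem_nth.
  by rewrite -xE index_uniq // (bfs_uniq I).
have Q'n : size (rcons Q y) <= n.
  rewrite -[X in _ <= X]card_ord -(card_uniqP _) ?max_card //.
  by rewrite rcons_uniq yQ (bfs_uniq I).
rewrite size_rcons in Q'n.
do 2! wp_step addn0; split; first lia.
have xy : (x == y) = false.
  by apply: contraNF yQ => /eqP <-; rewrite -xE mem_nth.
exists (rcons Q y), (fun v => if v == y then dx.+1 else D v).
split=> //=; try lia.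
- rewrite -dxE -xE; apply: bfs_discover => //; by rewrite xE.
- by rewrite size_rcons ltnW.
- by rewrite nth_rcons hQ.
- by rewrite -cats1 takel_cat.
- split=> //=; first by rewrite size_rcons addn1.
  + move=> v; have vn := ltn_ord v; rewrite ifF; last by lia.
    by rewrite eqn_add2l Edv DE.
  + move=> a; rewrite size_rcons ltnS leq_eqVlt nth_rcons => /orP[/eqP ->|alt].
      by rewrite !eqxx ltnn.
    rewrite alt ifF; last by lia.
    by rewrite ifF ?QE //; lia.
  + by move=> a a1 a2; rewrite /= ifF ?ifF ?ME //; lia.
- move=> z; rewrite takeS mem_rcons inE; case: eqP => //= _; exact: done.
Qed.

(** Time still owed to the vertices not yet processed: 30 steps and a loop test per neighbour, plus
    the overhead of a visit. *)
Definition pot (P : seq 'I_n) := \sum_(v | v \notin P) (31 * size (adj v) + 40).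

Lemma pot_rcons P x : x \notin P ->
  pot P = 31 * size (adj x) + 40 + pot (rcons P x).
Proof.
move=> xP; rewrite /pot (bigD1 x) //=; congr (_ + _).
by apply: eq_bigl => v; rewrite mem_rcons inE negb_or andbC.
Qed.

Lemma pot_nil : pot [::] = 31 * tot + 40 * n.
Proof.
rewrite /pot big_split /= -big_distrr /= tot_sum sum_nat_const card_ord.
by rewrite mulnC [n * _]mulnC mulnC.
Qed.

Definition visit_inv (t : nat) (s : state) := exists Q h D,
  [/\ bfs_inv e u Q h D, bfs_state Q D s, h <= size Q, regs s r_head = h
    & regs s r_g = (h < size Q) /\ t = pot (take h Q)].

Lemma bfs_visit_spec t s : visit_inv t s -> regs s r_g != 0 ->
  exists t1 t2, spec w bfs_visit s t1 (visit_inv t2) /\ t1 + t2 < t.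
Proof.
move=> [Q [h [D [I S hQ Eh [Eg ->]]]]]; rewrite Eg.
case: (ltnP h (size Q)) => // {}hQ _; set x := nth u Q h.
have xP : x \notin take h Q.
  by rewrite in_take ?mem_nth // index_uniq ?ltnn // (bfs_uniq I).
have PS : take h.+1 Q = rcons (take h Q) x by rewrite (take_nth u hQ).
exists (31 * size (adj x) + 39), (pot (take h.+1 Q)); split; last first.
  by rewrite PS (pot_rcons xP); move: (pot _) => p; lia.
case: (S) => [[E1 E2 E3 E4 [E5 E6 E7 E8 E10]] Edb Et DE QE ME].
have xn := ltn_ord x; have off := off_le x; have Qn := bfs_size I.
have Dx : D x <= h.
  have xQ : x \in Q by exact: mem_nth.
  by have := bfs_index I xQ; rewrite index_uniq // (bfs_uniq I).
have M1 : memory s (3 + x) = M0 (3 + x).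
  by rewrite ME ?m0E //; lia.
have M2 : memory s (3 + x + 1) = M0 (3 + x) + size (adj x).
  by rewrite ME ?m0E ?offS //; lia.
apply: (spec_seq (T1 := 23) (T2 := 31 * size (adj x) + 5)); last by lia.
apply: spec_wp; last by [].
rewrite /= /upd /= E6 Eh E1 Edb E3 E4.
have Qx : memory s (B0 + n + h) = x by rewrite QE.
do 12! wp_step (Qx, DE, M1, M2).
apply: (spec_seq (T1 := 31 * size (adj x) + 1) (T2 := 1)); last by lia.
apply: (spec_for (tb := 30) (N := size (adj x))
          (I := scan_inv x (D x) h (take h.+1 Q))).
- by move=> i s1 ilt; exact: bfs_scan_spec.
- by rewrite /=; lia.
- by exists Q, D; split=> //=; try lia; rewrite subnn take0.
- move=> s1 [Q1 [D1 [_ I1 hQ1 x1 P1 dx1 S1 Eh1 Edv1 Eptr1 done1]]].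
  apply: spec_wp; last by [].
  rewrite /= /upd /= Eh1 (bfs_tail S1); wp_step addn0.
  exists Q1, h.+1, D1; split=> //=.
  + apply: bfs_advance => // y; rewrite x1 dx1 => exy; apply: done1.
    by rewrite subn0 take_size adjE.
  + by case: S1 => *; split.
  + by rewrite P1.
- by lia.
Qed.

Lemma bfs_spec s : consts s -> regs s r_src = u -> regs s r_db = db ->
  memory s =1 m0 ->
  spec w bfs s (60 * (n + tot + 1))
    (fun s' => (forall v : 'I_n, memory s' (db + v) = graph_dist e u v)
               /\ bfs_outside s').
Proof.
move=> Cs Esrc Edb ME; case: (Cs) => [E1 E2 E3 E4 [E5 E6 E7 E8 E10]].
have un := ltn_ord u.
apply: (spec_seq (T1 := 1) (T2 := 60 * (n + tot + 1) - 3)); last by lia.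
apply: spec_wp; last by [].
rewrite /= /upd /= E2 E10; wp_step addn0.
apply: (spec_seq (T1 := 10 * n + 1) (T2 := 50 * n + 60 * tot + 50)); last by lia.
pose F i s := [/\ consts s, regs s r_db = db, regs s r_src = u,
  forall v, i <= v < n -> memory s (db + v) = n & bfs_outside s].
apply: (spec_for (tb := 9) (N := n) (I := F)).
- move=> i s1 ilt Ei [[H1 H2 H3 H4 [H5 H6 H7 H8 H10]] Hdb Hs HD HM].
  apply: spec_wp; last by [].
  rewrite /= /upd /= Ei H1 Hdb H2.
  do 2! wp_step addn0; split; first lia; split=> //=.
  + move=> v; case: eqP => // Ev vi; apply: HD; lia.
  + by move=> a a1 a2 /=; rewrite ifF ?HM //; lia.
- by [].
- by split=> //= [v|a _ _]; [lia | exact: ME].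
- move=> s1 [[H1 H2 H3 H4 [H5 H6 H7 H8 H10]] Hdb Hs HD HM].
  apply: (spec_seq (T1 := 11) (T2 := 31 * tot + 40 * n + 1)); last by lia.
  apply: spec_wp; last by [].
  rewrite /= /upd /= Hs Hdb H10 H6.
  wp_step addn0; do 3! [split; first lia].
  apply: (spec_while (P := visit_inv) (t := 31 * tot + 40 * n)).
  + exact: bfs_visit_spec.
  + move=> t s2 [Q [h [D [I S hQ Eh [Eg _]]]]]; rewrite Eg => hQ'.
    have DE := bfs_final I; split=> [v|]; last exact: bfs_mem S.
    by rewrite (bfs_D S) DE //; lia.
  + exists [:: u], 0, (fun v => if v == u then 0 else n).
    split=> //=; first exact: bfs_init; last by rewrite pot_nil.
    split=> //=.
    * move=> v; rewrite ifF; last by have := ltn_ord v; lia.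
      rewrite eqn_add2l -val_eqE; case: eqP => // _; apply: HD.
      by rewrite ltn_ord.
    * by case=> // _; rewrite addn0 eqxx.
    * by move=> a a1 a2 /=; rewrite ifF ?ifF ?HM //; lia.
  + by lia.
- by lia.
Qed.

End Bfs.

(** * Maintaining the farthest distances from a growing set *)

Local Notation dist := (graph_dist e).
Local Notation sz := (n + tot + 1).

Definition far (U : {set 'I_n}) (v : 'I_n) := \max_(u in U) dist u v.

Lemma farU1 u U v : far (u |: U) v = maxn (dist u v) (far U v).
Proof.
rewrite /far; have [uU|uU] := boolP (u \in U); last by rewrite big_setU1.
have -> : u |: U = U by apply/setUidPr; rewrite sub1set.
by apply/esym/maxn_idPr; exact: (@leq_bigmax_cond _ _ (fun u => dist u v)).
Qed.

Lemma dist_le_n u v : dist u v <= n.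
Proof. by have := graph_dist_le_card e u v; rewrite card_ord. Qed.

Lemma far_le_n U v : far U v <= n.
Proof. by apply/bigmax_leqP => u _; exact: dist_le_n. Qed.

(** The state between searches; the queue and both distance arrays are scratch space, so nothing is
    said about them. *)
Record ready (U : {set 'I_n}) (s : state) : Prop := Ready {
  ready_consts : consts s;
  ready_input : forall a, a < B0 -> memory s a = M0 a;
  ready_far : forall v : 'I_n, memory s (B0 + n + n + v) = far U v
}.

Lemma update_spec (u : 'I_n) U s : ready U s -> regs s r_src = u ->
  spec w update s (100 * sz) (fun s' => ready (u |: U) s' /\
    forall a, B0 + n + n + n <= a -> memory s' a = memory s a).
Proof.
move=> [Cs Min Mf] Eu; case: (Cs) => [E1 E2 E3 E4 [E5 E6 E7 E8 E10]].
apply: (spec_seq (T1 := 1) (T2 := 100 * sz - 3)); last by lia.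
apply: spec_wp; last by [].
rewrite /= /upd /= E5 E10; wp_step addn0.
apply: (spec_seq (T1 := 60 * sz) (T2 := 40 * sz - 4)); last by lia.
set s1 := State _ _ _; have C1 : consts s1 by [].
have H := bfs_spec (u := u) (or_introl erefl) Min C1 Eu erefl (fun=> erefl).
apply: spec_conseq (spec_frame H) _ _ => // {H} s2 [[HD HM] HR _ _].
have C2 : consts s2.
  by apply: consts_frame C1 => i i20; rewrite HR // !inE; lia.
case: (C2) => [H1 H2 H3 H4 [H5 H6 H7 H8 H10]].
apply: (spec_seq (T1 := 1) (T2 := 40 * sz - 7)); last by lia.
apply: spec_wp; last by [].
rewrite /= /upd /= H2 H10; wp_step addn0.
(* The counter descends, so the cells from [i] upwards are already updated. *)
pose J i s := [/\ consts s, forall a, a < B0 -> memory s a = M0 a,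
  forall v : 'I_n, memory s (B0 + v) = dist u v,
  forall v : 'I_n, memory s (B0 + n + n + v)
     = if i <= v then far (u |: U) v else far U v
  & forall a, B0 + n + n + n <= a -> memory s a = memory s1 a].
apply: (spec_for (tb := 20) (N := n) (I := J)).
- move=> i s3 ilt Ei [[F1 F2 F3 F4 [F5 F6 F7 F8 F10]] Fin FD Ff Fo].
  have [v vE] : exists v : 'I_n, i = v by exists (Ordinal ilt).
  have vn := ltn_ord v; rewrite vE {i ilt vE} in Ei Ff *.
  have Fv := Ff v; rewrite ltnn in Fv.
  have dn := dist_le_n u v; have fn := far_le_n U v; have FD' := FD v.
  have i1 : v.+1 - 1 = v by lia.
  apply: spec_wp; last by [].
  rewrite /= /upd /= Ei F1 F5 F7.
  do 6! wp_step (i1, Fv, FD').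
  have Fw (x : 'I_n) : (v < x) = (v <= x) && (x != v).
    by rewrite -val_eqE /=; lia.
  have fU := farU1 u U v.
  case: ltnP => cmp /=.
    split=> //; split=> //=.
    + by move=> a aB; rewrite ifF ?Fin //; lia.
    + by move=> x; rewrite ifF ?FD //; have := ltn_ord x; lia.
    + move=> x; rewrite eqn_add2l val_eqE; case: eqP => [->|/eqP xv].
        by rewrite leqnn fU; lia.
      by rewrite Ff Fw xv andbT.
    + by move=> a aB; rewrite ifF ?Fo //; lia.
  split; first lia; split=> //; split=> //= x.
  rewrite Ff Fw; case: eqP => [->|_]; last by rewrite andbT.
  by rewrite leqnn fU /=; lia.
- by [].
- split=> //=.
  + by move=> a aB; rewrite HM ?Min //; lia.
  + by move=> v; rewrite leqNgt ltn_ord /= HM ?Mf //; lia.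
  + by move=> a aB; rewrite HM //; lia.
- move=> s3 [F C D G K]; split=> //; split=> // v; exact: G.
- by lia.
Qed.

(** * Drawing the random sample *)

Definition bits_val (a : nat) (bs : seq bool) : nat :=
  foldl (fun a (b : bool) => a + a + b) a bs.

Lemma bits_val_lt bs : bits_val 0 bs < 2 ^ size bs.
Proof.
elim/last_ind: bs => [|bs b IH] //.
rewrite /bits_val foldl_rcons -/(bits_val 0 bs) size_rcons expnS.
by case: b; lia.
Qed.

(* Reduction modulo n is not uniform, but as n <= 2 ^ L < 2 * n every vertex   *)
(* is drawn with probability at least 1 / 2 ^ L.                              *)
Fixpoint draws (L j : nat) (cs : seq bool) : seq nat :=
  if j is j'.+1 then bits_val 0 (take L cs) %% n :: draws L j' (drop L cs)
  else [::].

Definition drawn L j cs := [set v : 'I_n | val v \in draws L j cs].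

Lemma bits_lt_word L : 2 ^ L <= 2 * n -> L < 2 ^ w.
Proof.
move=> Ln; apply: leq_trans (_ : 2 * n <= _); last by lia.
by apply: leq_trans Ln; exact: ltn_expl.
Qed.

Lemma sample_loop_spec L s T Q : consts s -> 2 ^ L <= 2 * n ->
  L <= size (coins s) -> regs s r_cnt = L -> regs s r_src = 0 ->
  (forall s', memory s' = memory s -> coins s' = drop L (coins s) ->
    regs s' r_src = bits_val 0 (take L (coins s)) ->
    (forall i, i \notin written sample_bit -> regs s' i = regs s i) -> Q s') ->
  8 * L < T -> spec w (While r_cnt sample_bit) s T Q.
Proof.
move=> Cs Ln Lc EL E0 HQ LT; have LL := bits_lt_word Ln.
pose J i s' := [/\ regs s' r_one = 1, coins s' = drop (L - i) (coins s)
  & regs s' r_src = bits_val 0 (take (L - i) (coins s))].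
have H : spec w (While r_cnt sample_bit) s (8 * L + 1) (J 0).
  apply: (spec_for (tb := 7) (N := L) (I := J)) => //; last by lia.
  - move=> i s1 iL Ei [F1 Fc Fs].
    have ltc : L - i.+1 < size (coins s) by lia.
    have E : L - i = (L - i.+1).+1 by lia.
    have takeS : take (L - i) (coins s)
        = rcons (take (L - i.+1) (coins s)) (nth false (coins s) (L - i.+1)).
      by rewrite E (take_nth false).
    have val_lt : bits_val 0 (take (L - i) (coins s)) < 2 * n.
      apply: leq_trans Ln; apply: leq_trans (bits_val_lt _) _.
      by rewrite leq_exp2l // size_takel; lia.
    have valE : bits_val 0 (take (L - i) (coins s)) =
        bits_val 0 (take (L - i.+1) (coins s))
        + bits_val 0 (take (L - i.+1) (coins s)) + nth false (coins s) (L - i.+1).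
      by rewrite takeS /bits_val foldl_rcons.
    have hdE : head false (coins s1) = nth false (coins s) (L - i.+1).
      by rewrite Fc -nth0 nth_drop addn0.
    apply: spec_wp; last by [].
    rewrite /= /upd /= Ei F1 Fs hdE.
    wp_step addn0; split; first by lia.
    do 2! wp_step addn0; split; first by lia.
    split=> //=; first by rewrite Fc -drop1 drop_drop E add1n.
  - by split; rewrite ?subnn ?drop0 ?take0 //; case: Cs.
apply: spec_conseq (spec_frame H) _ _; first by lia.
move=> s' [[_ Fc Fs] HR _ HM]; rewrite subn0 in Fc Fs; apply: HQ => //; exact: HM.
Qed.

(** The final sample [U0] is the present set together with what the remaining coins will yield, so
    it is a function of the initial coins. *)
Definition sampling_inv L U0 i s := exists U,
  [/\ ready U s, regs s r_bits = L, i * L <= size (coins s)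
    & U :|: drawn L i (coins s) = U0].

Lemma sample_step_spec L U0 i s : 0 < n -> 2 ^ L <= 2 * n ->
  regs s r_samples = i.+1 -> i.+1 < 2 ^ w -> sampling_inv L U0 i.+1 s ->
  spec w sample_step s (8 * L + 110 * sz)
    (fun s' => regs s' r_samples = i /\ sampling_inv L U0 i s').
Proof.
move=> n0 Ln Ei iw [U [[Cs Min Mf] EL sc UE]].
case: (Cs) => [E1 E2 E3 E4 [E5 E6 E7 E8 E10]].
have LL := bits_lt_word Ln.
apply: (spec_seq (T1 := 1) (T2 := 8 * L + 110 * sz - 3)); last by lia.
apply: spec_wp; last by [].
rewrite /= /upd /= Ei E1; wp_step addn0.
apply: (spec_seq (T1 := 1) (T2 := 8 * L + 110 * sz - 5)); last by lia.
apply: spec_wp; last by [].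
rewrite /= /upd /=; split; first by lia.
apply: (spec_seq (T1 := 1) (T2 := 8 * L + 110 * sz - 7)); last by lia.
apply: spec_wp; last by [].
rewrite /= /upd /= EL E10 ; wp_step addn0.
apply: (spec_seq (T1 := 8 * L + 1) (T2 := 110 * sz - 10)); last by lia.
apply: (sample_loop_spec (L := L)) => //=; try lia.
move=> s1 HM Hc Hs HR.
have HR' j : j \notin [:: r_cnt; r_src; r_samples; r_c] -> regs s1 j = regs s j.
  rewrite !inE !negb_or => /and4P[/negPf a /negPf b /negPf c /negPf d].
  by rewrite HR /= ?a ?b ?c // !inE a b d.
have C1 : consts s1.
  by apply: consts_frame Cs => j j20; apply: HR'; rewrite !inE; lia.
apply: (spec_seq (T1 := 1) (T2 := 110 * sz - 12)); last by lia.
set a := bits_val 0 _ in Hs.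
have an : a %% n < n by rewrite ltn_mod.
apply: spec_wp; last by [].
rewrite /= /upd /= Hs HR' // E2; wp_step addn0.
set s2 := State _ _ _.
have R2 : ready U s2.
  split=> [|b|v]; [by case: C1 | by move=> b0; rewrite /= HM Min | ].
  by rewrite /= HM Mf.
have H := update_spec (u := Ordinal an) R2 erefl.
apply: spec_conseq (spec_frame H) _ _; first by lia.
move=> s3 [[R3 _] HR3 /(_ isT) Hc3 _]; split.
  by rewrite HR3 //= HR //=; lia.
exists (Ordinal an |: U); split=> //.
- by rewrite HR3 //= HR'.
- by rewrite Hc3 /= Hc size_drop; lia.
- rewrite -UE Hc3 /= Hc; apply/setP => v; rewrite !inE -val_eqE /=.
  by rewrite -/a orbA; congr (_ || _); exact: orbC.
Qed.

Lemma sampling_spec L ns s T Q : 0 < n -> 2 ^ L <= 2 * n ->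
  ns < 2 ^ w -> regs s r_samples = ns -> regs s r_bits = L -> ready set0 s ->
  ns * L <= size (coins s) ->
  (forall s', ready (drawn L ns (coins s)) s' ->
    (forall i, i \notin written sample_step -> regs s' i = regs s i) -> Q s') ->
  ns * (8 * L + 110 * sz + 1) < T ->
  spec w (While r_samples sample_step) s T Q.
Proof.
move=> n0 Ln nw En EL R0 sc HQ nT.
pose D := drawn L ns (coins s).
have H : spec w (While r_samples sample_step) s (ns * (8 * L + 110 * sz + 1) + 1)
    (sampling_inv L D 0).
  apply: (spec_for (tb := 8 * L + 110 * sz) (N := ns) (I := sampling_inv L D)).
  - by move=> i s1 ilt Ei; apply: sample_step_spec => //; apply: leq_ltn_trans nw.
  - by [].
  - by exists set0; rewrite set0U.
  - by [].
  - by rewrite !addn1.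
apply: spec_conseq (spec_frame H) _ _; first by lia.
move=> s' [[U [R1 _ _ UE]] HR _ _]; apply: HQ => //.
rewrite -/D -UE; suff -> : drawn L 0 (coins s') = set0 by rewrite setU0.
by apply/setP => v; rewrite !inE.
Qed.

(** * One round: a candidate center and its violators *)

Lemma argmin_spec U s : 0 < n -> ready U s ->
  spec w argmin s (30 * sz) (fun s' => exists x : 'I_n,
    [/\ regs s' r_src = x, regs s' r_out = far U x
      & forall y, far U x <= far U y]).
Proof.
move=> n0 [Cs _ Mf]; case: (Cs) => [E1 E2 E3 E4 [E5 E6 E7 E8 E10]].
pose o := Ordinal n0.
have Mo : memory s (B0 + n + n) = far U o by rewrite -(Mf o) addn0.
have fo := far_le_n U o.
apply: (spec_seq (T1 := 1) (T2 := 30 * sz - 3)); last by lia.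
apply: spec_wp; last by [].
rewrite /= /upd /=; split; first by lia.
apply: (spec_seq (T1 := 1) (T2 := 30 * sz - 5)); last by lia.
apply: spec_wp; last by [].
rewrite /= /upd /= E7; wp_step Mo.
apply: (spec_seq (T1 := 1) (T2 := 30 * sz - 7)); last by lia.
apply: spec_wp; last by [].
rewrite /= /upd /= E2 E10; wp_step addn0.
pose J i s' := [/\ consts s', memory s' = memory s & exists x : 'I_n,
    [/\ regs s' r_src = x, regs s' r_out = far U x
      & forall y : 'I_n, i <= y -> far U x <= far U y]].
apply: (spec_for (tb := 20) (N := n) (I := J)).
- move=> i s3 ilt Ei [[F1 F2 F3 F4 [F5 F6 F7 F8 F10]] FM [x [Fs Fo Fle]]].
  have [v vE] : exists v : 'I_n, i = v by exists (Ordinal ilt).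
  have vn := ltn_ord v; rewrite vE {i ilt vE} in Ei Fle *.
  have i1 : v.+1 - 1 = v by lia.
  have fn := far_le_n U v.
  apply: spec_wp; last by [].
  rewrite /= /upd /= Ei F1 F7 FM Fo F10.
  do 4! wp_step (i1, Mf).
  have Fw (y : 'I_n) : v <= y -> y = v \/ v < y.
    by rewrite leq_eqVlt => /orP[/eqP/val_inj ->|]; [left|right].
  case: ltnP => cmp /=.
    do 2! wp_step addn0; split=> //; split=> //; exists v; split=> // y /Fw[->//|].
    by move=> /Fle; apply: leq_trans; exact: ltnW.
  by split; first lia; split=> //; split=> //; exists x; split=> // y /Fw[->//|/Fle].
- by [].
- split=> //; exists o; split=> // y; by rewrite leqNgt ltn_ord.
- by move=> s3 [_ _ [x [Fs Fo Fle]]]; exists x; split=> // y; exact: Fle.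
- by lia.
Qed.

Definition violators (U : {set 'I_n}) (x : 'I_n) := [set v | far U x < dist x v].

(** The distances from [x] sit in the last array, which [update] leaves intact, so violators can be
    inserted while they are being listed. *)
Lemma violators_loop_spec U x s T Q : ready U s -> regs s r_cell = n ->
  regs s r_out = far U x ->
  (forall v : 'I_n, memory s (B0 + n + n + n + v) = dist x v) ->
  (forall s', ready (U :|: violators U x) s' ->
    (forall i, i \notin written violator_cell -> regs s' i = regs s i) -> Q s') ->
  21 * n + #|violators U x| * (110 * sz) < T ->
  spec w (While r_cell violator_cell) s T Q.
Proof.
move=> R0 En Eout MD HQ HT; set W := violators U x in HQ HT.
pose J i s' := [/\ ready (U :|: [set v in W | i <= v]) s',
  regs s' r_out = far U x
  & forall v : 'I_n, memory s' (B0 + n + n + n + v) = dist x v].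
have H : spec w (While r_cell violator_cell) s T (J 0).
  (* Only violators pay for a search. *)
  pose tb i := 20 + (i \in [seq val v | v in W]) * (110 * sz).
  apply: (spec_for_sum (tb := tb) (N := n) (I := J)).
  - move=> i s1 ilt Ei [R1 Fo FD].
    case: (R1) => [[F1 F2 F3 F4 [F5 F6 F7 F8 F10]] Fin Ff].
    have [v vE] : exists v : 'I_n, i = v by exists (Ordinal ilt).
    have vn := ltn_ord v; rewrite vE {i ilt vE} in Ei R1 Ff *.
    have i1 : v.+1 - 1 = v by lia.
    have fn := far_le_n U x; have dn := dist_le_n x v.
    have vW : (val v \in [seq val v | v in W]) = (v \in W).
      by rewrite mem_map ?mem_enum //; exact: val_inj.
    have Fw (y : 'I_n) : (v <= y) = (y == v) || (v < y).
      by rewrite leq_eqVlt eq_sym.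
    rewrite /tb vW.
    apply: (spec_seq (T1 := 1) (T2 := 18 + (v \in W) * (110 * sz))); last by lia.
    apply: spec_wp; last by [].
    rewrite /= /upd /= Ei F1; wp_step i1.
    apply: (spec_seq (T1 := 1) (T2 := 16 + (v \in W) * (110 * sz))); last by lia.
    apply: spec_wp; last by [].
    rewrite /= /upd /= F8; wp_step i1.
    apply: (spec_seq (T1 := 1) (T2 := 14 + (v \in W) * (110 * sz))); last by lia.
    apply: spec_wp; last by [].
    rewrite /= /upd /=; wp_step FD.
    apply: (spec_seq (T1 := 1) (T2 := 12 + (v \in W) * (110 * sz))); last by lia.
    apply: spec_wp; last by [].
    rewrite /= /upd /= Fo; wp_step addn0.
    have -> : (far U x < dist x v) = (v \in W) by rewrite inE.
    apply: spec_if; rewrite /=; last first.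
      case: (boolP (v \in W)) => // vnW _.
      apply: spec_wp; last by [].
      split; first by lia.
      split=> //; split=> //=; split=> //= y.
      rewrite Ff; congr (far (_ :|: _) _); apply/setP => z; rewrite !inE Fw.
      case: (eqVneq z v) => [->|//]; rewrite inE in vnW.
      by rewrite (negPf vnW).
    case: (boolP (v \in W)) => // vW' _.
    apply: (spec_seq (T1 := 1) (T2 := 105 * sz)); last by lia.
    apply: spec_wp; last by [].
    rewrite /= /upd /= F10; wp_step addn0.
    set s2 := State _ _ _; have R2 : ready (U :|: [set v0 in W | v < v0]) s2 by [].
    have E2 : regs s2 r_src = v by [].
    apply: spec_conseq (spec_frame (update_spec R2 E2)) _ _; first by lia.
    move=> s3 [[R3 M3] HR _ _]; split; first by rewrite HR.
    split; last 1 first.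
    + by move=> y; rewrite M3 ?FD //; lia.
    + rewrite (_ : _ :|: _ = v |: (U :|: [set v0 in W | v < v0])) //.
      apply/setP => z; rewrite !inE Fw; case: (eqVneq z v) => [->|//] /=.
      by rewrite inE in vW'; rewrite vW' orbT.
    + by rewrite HR.
  - by [].
  - split=> //; rewrite (_ : _ :|: _ = U) //; apply/setP => v.
    by rewrite !inE [n <= v]leqNgt ltn_ord andbF orbF.
  - by [].
  - rewrite /tb; under eq_bigr do rewrite -addn1 -addnA addnC -addnA.
    rewrite big_split /= -big_distrl /= big_split /= !sum_nat_const card_ord.
    suff -> : \sum_(i < n) (val i \in [seq val v | v in W]) = #|W| by lia.
    rewrite -sum1_card [RHS]big_mkcond; apply: eq_bigr => v _ /=.
    rewrite mem_map ?mem_enum; last exact: val_inj.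
    by case: (v \in W).
apply: spec_conseq (spec_frame H) _ _ => // s' [[R1 _ _] HR _ _]; apply: HQ => //.
rewrite (_ : W = [set v in W | 0 <= v]) //; apply/setP => v.
by rewrite [RHS]inE andbT.
Qed.

Lemma round_spec U i c s : 0 < n -> ready U s -> regs s r_rounds = i.+1 ->
  i.+1 < 2 ^ w -> (forall x, #|violators U x| <= c) ->
  spec w round s ((150 + 110 * c) * sz) (fun s' => exists x : 'I_n,
    [/\ regs s' r_rounds = i, regs s' r_out = far U x,
        forall y, far U x <= far U y & ready (U :|: violators U x) s']).
Proof.
move=> n0 R0 Ei iw Hc; case: (R0) => Cs Min Mf.
case: (Cs) => [E1 E2 E3 E4 [E5 E6 E7 E8 E10]].
apply: (spec_seq (T1 := 1) (T2 := (150 + 110 * c) * sz - 3)); last by lia.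
apply: spec_wp; last by [].
rewrite /= /upd /= Ei E1; wp_step addn0.
apply: (spec_seq (T1 := 30 * sz) (T2 := (120 + 110 * c) * sz - 5)); last by lia.
set s1 := State _ _ _; have R1 : ready U s1 by [].
apply: spec_conseq (spec_frame (argmin_spec n0 R1)) _ _ => //.
move=> s2 [[x [Es Eo xmin]] HR2 _ /(_ isT) HM2].
have C2 : consts s2.
  by apply: consts_frame (ready_consts R1) => j j20; rewrite HR2 // !inE; lia.
case: (C2) => [H1 H2 H3 H4 [H5 H6 H7 H8 H10]].
apply: (spec_seq (T1 := 1) (T2 := (120 + 110 * c) * sz - 7)); last by lia.
apply: spec_wp; last by [].
rewrite /= /upd /= H8 H10; wp_step addn0.
apply: (spec_seq (T1 := 60 * sz) (T2 := (60 + 110 * c) * sz - 8)); last by lia.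
set s3 := State _ _ _; have C3 : consts s3 by [].
have Min3 a : a < B0 -> memory s3 a = M0 a by rewrite /= HM2; exact: Min.
have H := bfs_spec (u := x) (or_intror erefl) Min3 C3 Es erefl (fun=> erefl).
apply: spec_conseq (spec_frame H) _ _ => // {H} s4 [[HD HM] HR4 _ _].
have C4 : consts s4.
  by apply: consts_frame C3 => j j20; rewrite HR4 // !inE; lia.
case: (C4) => [G1 G2 G3 G4 [G5 G6 G7 G8 G10]].
apply: (spec_seq (T1 := 1) (T2 := (60 + 110 * c) * sz - 10)); last by lia.
apply: spec_wp; last by [].
rewrite /= /upd /= G2 G10; wp_step addn0.
apply: (violators_loop_spec (U := U) (x := x)) => //=.
- split=> //= [a a0|v]; first by rewrite HM ?Min3 //; lia.
  by have := ltn_ord v => vn; rewrite HM /= ?HM2 /= ?Mf //; lia.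
- by rewrite HR4.
- move=> s5 R5 HR5; exists x; split=> //.
  + by rewrite HR5 //= HR4 //= HR2 //=; lia.
  + by rewrite HR5 //= HR4.
- have := Hc x; move: #|_| => d; nia.
Qed.

(** * Convergence of the rounds to the radius *)

Lemma far_mono (U U' : {set 'I_n}) x : U \subset U' -> far U x <= far U' x.
Proof.
move=> /subsetP UU'; apply/bigmax_leqP => u /UU' uU'.
exact: (@leq_bigmax_cond _ _ (fun u => dist u x)).
Qed.

(** A ball containing [U] leaves at most n / q vertices outside. The property passes to supersets,
    so it bounds the violators in every round. *)
Definition spread (q : nat) (U : {set 'I_n}) := forall (x : 'I_n) (r : nat),
  (forall u, u \in U -> dist u x <= r) -> #|[set v | r < dist x v]| * q <= n.

Section Rounds.
Hypothesis e_sym : symmetric e.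
Variables (rho k q : nat) (B U0 : {set 'I_n}).
Hypothesis n_gt0 : 0 < n.
Hypothesis q_gt0 : 0 < q.
Hypothesis center : exists c, forall u, dist u c <= rho.
Hypothesis B_far : forall x, exists2 b, b \in B & rho <= dist b x.
Hypothesis B_card : #|B| <= k.
Hypothesis U0_spread : spread q U0.
Hypothesis k_lt_w : k.+1 < 2 ^ w.

(** With [i] rounds left, either the minimum of [far] has reached [rho], and later rounds output
    [rho], or fewer than [i] vertices of [B] are missing from [U]. *)
Definition rounds_inv i s := exists U : {set 'I_n},
  [/\ U0 \subset U, ready U s,
      (forall x, rho <= far U x) \/ #|B :\: U| < i
    & i = 0 -> regs s r_out = rho].

(** The minimum is at most [rho] because of [center]. If it is smaller, the vertex of [B] far from
    [x] is outside [U] and is a violator, so inserting the violators brings in a new vertex of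
    [B]. *)
Lemma rounds_inv_step (U : {set 'I_n}) x i s : U0 \subset U ->
  (forall x, rho <= far U x) \/ #|B :\: U| < i.+1 ->
  (forall y, far U x <= far U y) -> ready (U :|: violators U x) s ->
  regs s r_out = far U x -> rounds_inv i s.
Proof.
move=> UU0 prog xmin R1 Eo; exists (U :|: violators U x).
have Ux_le : far U x <= rho.
  have [c hc] := center; apply: leq_trans (xmin c) _.
  by apply/bigmax_leqP => u _.
have [le|lt] := leqP rho (far U x).
  split=> //; first exact: subset_trans (subsetUl _ _).
    left=> y; apply: leq_trans le (leq_trans (xmin y) _).
    by apply: far_mono; exact: subsetUl.
  by rewrite Eo => _; apply/eqP; rewrite eqn_leq Ux_le.
have [b bB bx] := B_far x.
have bU : b \notin U.
  apply: contraL lt => bU; rewrite -leqNgt; apply: leq_trans bx _.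
  exact: (@leq_bigmax_cond _ _ (fun u => dist u x)).
have bW : b \in violators U x.
  by rewrite inE (graph_dist_sym e_sym); exact: leq_trans bx.
case: prog => [/(_ x)|prog]; first by rewrite leqNgt lt.
have lt_card : #|B :\: (U :|: violators U x)| < #|B :\: U|.
  apply: proper_card; apply/properP; split.
    by apply: setDS; exact: subsetUl.
  by exists b; rewrite !in_setD ?bB ?bU // in_setU bW orbT.
split=> //; first exact: subset_trans (subsetUl _ _).
  by right; lia.
by move=> i0; lia.
Qed.

Lemma rounds_spec s T : ready U0 s -> regs s r_rounds = k.+1 ->
  k.+1 * ((150 + 110 * (n %/ q)) * sz + 1) < T ->
  spec w (While r_rounds round) s T (fun s' => regs s' r_out = rho).
Proof.
move=> R0 Ek kT.
apply: (spec_for (tb := (150 + 110 * (n %/ q)) * sz) (N := k.+1)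
          (I := rounds_inv)) => //.
- move=> i s1 ik Ei [U [U0U R1 prog _]].
  have Hc x : #|violators U x| <= n %/ q.
    rewrite leq_divRL //; apply: U0_spread => u uU0.
    apply: (@leq_bigmax_cond _ _ (fun u => dist u x)).
    exact: (subsetP U0U).
  have H := round_spec n_gt0 R1 Ei (leq_ltn_trans ik k_lt_w) Hc.
  apply: spec_conseq H _ _ => // s2 [x [Er Eo xmin R2]]; split=> //.
  exact: rounds_inv_step U0U prog xmin R2 Eo.
- exists U0; split=> //; right; rewrite ltnS; apply: leq_trans B_card.
  exact/subset_leq_card/subsetDl.
- by move=> s' [U [_ _ _ H]]; exact: H.
- by rewrite -[X in _ * X]addn1.
Qed.

End Rounds.

(** * Rounded square root and logarithm *)

Lemma sqrt_spec s kn : regs s r_one = 1 -> regs s r_y = kn -> regs s r_q = 0 ->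
  regs s r_g = 1 -> 0 < kn <= n * n -> n * n + n < 2 ^ w ->
  spec w (While r_g sqrt_step) s (10 * n + 11) (fun s' => exists q,
    [/\ regs s' r_q = q, 0 < q, kn <= q * q & q.-1 * q.-1 < kn]).
Proof.
move=> E1 Ey Eq Eg kn0 nw.
pose P t s' := exists q, [/\ regs s' r_one = 1, regs s' r_y = kn,
  regs s' r_q = q, regs s' r_g = (q * q < kn)
  & q.-1 * q.-1 < kn /\ t = 10 * (n.+1 - q)].
apply: (spec_while (P := P) (t := 10 * n.+1)); last by lia.
- move=> t s1 [q [F1 Fy Fq Fg [Fp ->]]]; rewrite Fg.
  case: ltnP => // qq _; exists 5, (10 * (n.+1 - q.+1)).
  (* As kn <= n^2, the linear search stops by q = n, and its squares fit in a word. *)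
  have qn : q < n by nia.
  have q1 : q + 1 = q.+1 by lia.
  split; last by lia.
  apply: spec_wp; last by [].
  rewrite /= /upd /= Fq F1 Fy.
  do 3! (move=> ? ->; rewrite ?q1; split; first nia).
  by exists q.+1.
- move=> t s1 [q [F1 Fy Fq Fg [Fp _]]]; rewrite Fg.
  case: ltnP => // qq _; exists q; split=> //.
  by case: (q) qq => //; lia.
- by exists 0; split=> //; rewrite ?Eg //; [lia | split; lia].
Qed.

Lemma log_spec s : 0 < n -> regs s r_one = 1 -> regs s r_n = n ->
  regs s r_bits = 0 -> regs s r_t = 1 -> regs s r_g = (1 < n) ->
  spec w (While r_g log_step) s (10 * n + 11) (fun s' => exists L,
    [/\ regs s' r_bits = L, n <= 2 ^ L & 2 ^ L < 2 * n]).
Proof.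
move=> n0 E1 En EL Et Eg.
pose P t s' := exists L, [/\ regs s' r_one = 1, regs s' r_n = n,
  regs s' r_bits = L, regs s' r_t = 2 ^ L & regs s' r_g = (2 ^ L < n) /\
  2 ^ L < 2 * n /\ t = 10 * (n.+1 - L)].
apply: (spec_while (P := P) (t := 10 * n.+1)); last by lia.
- move=> t s1 [L [F1 Fn FL Ft [Fg [Fp ->]]]]; rewrite Fg.
  case: ltnP => // Ln _; exists 5, (10 * (n.+1 - L.+1)).
  have LL := ltn_expl L (isT : 1 < 2).
  have dbl : 2 ^ L + 2 ^ L = 2 ^ L.+1 by rewrite expnS mul2n addnn.
  split; last by lia.
  apply: spec_wp; last by [].
  rewrite /= /upd /= FL F1 Ft Fn.
  do 3! wp_step dbl.
  by exists L.+1; split=> //; [rewrite /= addn1 | split=> //; split=> //; lia].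
- move=> t s1 [L [F1 Fn FL Ft [Fg [Fp _]]]]; rewrite Fg.
  by case: ltnP => // Ln _; exists L.
- by exists 0; split=> //; split=> //; split=> //; lia.
Qed.

(** * The whole program *)

Section Main.
Hypothesis e_sym : symmetric e.
Variables (rho k q L : nat) (B : {set 'I_n}) (s : state).
(** [B] never has more than n elements, so min (k, n) rounds of progress suffice; this choice also
    gives q <= n. *)
Local Notation k' := (minn k n).
Hypothesis n_gt0 : 0 < n.
Hypothesis k_gt0 : 0 < k.
Hypothesis center : exists c, forall u, dist u c <= rho.
Hypothesis B_far : forall x, exists2 b, b \in B & rho <= dist b x.
Hypothesis B_card : #|B| <= k'.
Hypothesis w_large' : 20 + 20 * n + tot + 6 * (n * n) + k < 2 ^ w.
Hypothesis M0_n : M0 0 = n.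
Hypothesis M0_k : M0 2 = k.
Hypothesis M0_tot : M0 (3 + n) = tot.
Hypothesis M0_out : forall a, B0 <= a -> M0 a = 0.
Hypothesis s_mem : memory s =1 M0.
Hypothesis n_le_tot : n <= tot.
Hypothesis q_ge : k' * n <= q * q.
Hypothesis q_lt : q.-1 * q.-1 < k' * n.
Hypothesis L_ge : n <= 2 ^ L.
Hypothesis L_lt : 2 ^ L < 2 * n.
Hypothesis coins_large : 6 * q * L * L <= size (coins s).
Hypothesis s_spread : spread q (drawn L (6 * q * L) (coins s)).

Lemma main_q_gt0 : 0 < q.
Proof.
have : 0 < k' * n by rewrite muln_gt0; lia.
by case: (q) q_ge => //; lia.
Qed.

(** The loop guarantees only these inequalities, while [s_spread] speaks of a [q] fixed in advance;
    the inequalities determine it. *)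
Lemma main_q_uniq q' : 0 < q' -> k' * n <= q' * q' -> q'.-1 * q'.-1 < k' * n ->
  q' = q.
Proof. by have := main_q_gt0; nia. Qed.

Lemma main_L_uniq L' : n <= 2 ^ L' -> 2 ^ L' < 2 * n -> L' = L.
Proof.
have le i j : n <= 2 ^ i -> 2 ^ j < 2 * n -> j <= i.
  move=> ni jn; rewrite leqNgt; apply/negP => ij.
  have : 2 ^ i.+1 <= 2 ^ j by rewrite leq_exp2l.
  by rewrite expnS; lia.
by move=> a b; apply/eqP; rewrite eqn_leq; apply/andP; split; exact: le.
Qed.

Lemma main_q_le : q <= n.
Proof. by have := main_q_gt0; have : k' <= n := geq_minr _ _; nia. Qed.

Lemma main_L_le : L <= n.
Proof.
case: (L) L_lt => // l; rewrite expnS.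
by have := ltn_expl l (isT : 1 < 2); lia.
Qed.

Lemma radius_prog_spec :
  spec w radius_prog s
    (k'.+1 * ((150 + 110 * (n %/ q)) * sz + 1)
     + 6 * q * L * (8 * L + 110 * sz + 1) + 20 * n + 200)
    (fun s' => regs s' r_out = rho).
Proof.
set tr := _ * (_ * sz + 1); set ts := _ * (8 * L + _ + 1).
have qn := main_q_le; have Ln := main_L_le.
have kn : k' <= n := geq_minr _ _.
have k'0 : 0 < k' by lia.
have qL : q * L <= n * n by exact: leq_mul.
have kkn : 0 < k' * n <= n * n by rewrite muln_gt0 k'0 n_gt0 leq_mul.
apply: (spec_seq (T1 := 13) (T2 := tr + ts + 20 * n + 180)); last by lia.
apply: spec_wp; last by [].
rewrite /= /upd /=.
do 3! [split; first lia].
wp_step (s_mem, M0_n); wp_step addn0; wp_step (s_mem, M0_tot).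
wp_step addn0.
have -> : tr + ts + 20 * n + 180 = (tr + ts + 20 * n + 179).+1 by lia.
apply: spec_if => [|_]; rewrite /=; first by rewrite ltnNge n_le_tot.
apply: (spec_seq (T1 := 20) (T2 := tr + ts + 20 * n + 150)); last by lia.
apply: spec_wp; last by [].
rewrite /= /upd /=.
split; first lia; wp_step (s_mem, M0_k).
do 6! wp_step addn0.
pose S0 r := consts (State r (memory s) (coins s)) /\ r r_k = k'.
(* Both branches of the conditional leave min (k, n) in [r_k], so the rest is treated once, for any
   registers satisfying [S0]. *)
suff H r : S0 r -> spec w (sqrt_start ;; While r_g sqrt_step ;; log_start ;;
    While r_g log_step ;; sample_start ;; While r_samples sample_step ;;
    Binop OpAdd r_rounds r_k r_one ;; While r_rounds round)
    (State r (memory s) (coins s)) (tr + ts + 20 * n + 150)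
    (fun s' => regs s' r_out = rho).
  have n4 : 3 + n + 1 = 4 + n by lia.
  rewrite ?n4; case: ltnP => kn' /=; [split; first lia | wp_step addn0].
    by apply: H; split=> //=; lia.
  by apply: H; split=> //=; lia.
rewrite /S0 /consts /= => -[[E1 E2 E3 E4 [E5 E6 E7 E8 E10]] Ek].
apply: (spec_seq (T1 := 5) (T2 := tr + ts + 20 * n + 140)); last by lia.
apply: spec_wp; last by [].
rewrite /= /upd /= Ek E2 .
move=> ? ->; split; first by move: (k' * n) kkn => m; lia.
do 2! [split; first lia].
set s1 := State _ _ _.
apply: (spec_seq (T1 := 10 * n + 11) (T2 := tr + ts + 10 * n + 120)); last by lia.
have nnw : n * n + n < 2 ^ w by lia.
have H := @sqrt_spec s1 (k' * n) E1 erefl erefl erefl kkn nnw.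
apply: spec_conseq (spec_frame H) _ _ => // {H} s2.
move=> [[q' [Eq q'0 q'1 q'2]] HR2 /(_ isT) Hc2 /(_ isT) HM2].
rewrite (main_q_uniq q'0 q'1 q'2) {q' q'0 q'1 q'2} in Eq.
apply: (spec_seq (T1 := 5) (T2 := tr + ts + 10 * n + 110)); last by lia.
apply: spec_wp; last by [].
rewrite /= /upd /=; do 2! [split; first lia].
rewrite HR2 //= E2; wp_step addn0.
apply: (spec_seq (T1 := 10 * n + 11) (T2 := tr + ts + 80)); last by lia.
set s3 := State _ _ _.
have E1' : regs s3 r_one = 1 by rewrite /= HR2.
have E2' : regs s3 r_n = n by rewrite /= HR2.
have H := log_spec n_gt0 E1' E2' erefl erefl erefl.
apply: spec_conseq (spec_frame H) _ _ => // {H} s4.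
move=> [[L' [EL L'1 L'2]] HR4 /(_ isT) Hc4 /(_ isT) HM4].
rewrite (main_L_uniq L'1 L'2) {L' L'1 L'2} in EL.
apply: (spec_seq (T1 := 5) (T2 := tr + ts + 70)); last by lia.
apply: spec_wp; last by [].
rewrite /= /upd /=; split; first lia.
rewrite EL HR4 //= Eq; do 2! wp_step addn0.
apply: (spec_seq (T1 := ts + 1) (T2 := tr + 60)); last by lia.
have HR i : i \in [:: 1; 2; 3; 4; 5; 6; 7; 8; 9; 10] -> regs s4 i = r i.
  by rewrite !inE => iE; rewrite HR4 ?HR2 //= ?HR2 //=; move: iE;
    do 9? [case/orP => [/eqP -> //|]]; move/eqP => ->.
apply: (sampling_spec (L := L) (ns := 6 * q * L)) => //=; try lia.
- split=> //=; first by rewrite /consts /= !HR.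
  + by move=> a a0; rewrite HM4 /= HM2 /=.
  (* Cells past the input hold 0, which is [far] of the empty set: the array is initialized for
     free. *)
  + move=> v; rewrite HM4 /= HM2 /= s_mem M0_out; last by lia.
    by rewrite /far big_set0.
- by rewrite Hc4 /= Hc2.
- move=> s5 R5 HR5.
  apply: (spec_seq (T1 := 1) (T2 := tr + 1)); last by lia.
  have [F1 F2 F3 F4 [F5 F6 F7 F8 F10]] := ready_consts R5.
  apply: spec_wp; last by [].
  rewrite /= /upd /= HR5 //= HR // Ek F1; wp_step addn0.
  have kw : k'.+1 < 2 ^ w by lia.
  rewrite Hc4 /= Hc2 in R5.
  apply: (rounds_spec e_sym n_gt0 main_q_gt0 center B_far B_card s_spread kw).
  + by case: R5 => *; split.
  + by rewrite /= addn1.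
  + by rewrite [tr + 1]addn1 ltnS.
Qed.

End Main.

Lemma radius_prog_sparse s : M0 0 = n -> M0 (3 + n) = tot -> memory s =1 M0 ->
  tot < n -> spec w radius_prog s 20 (fun s' => regs s' r_out = n).
Proof.
move=> M0_n M0_tot s_mem tn.
apply: (spec_seq (T1 := 13) (T2 := 2)); last by lia.
apply: spec_wp; last by [].
rewrite /= /upd /=.
do 3! [split; first lia].
wp_step (s_mem, M0_n); wp_step addn0; wp_step (s_mem, M0_tot); wp_step addn0.
apply: spec_if; rewrite /= tn // => _.
by apply: spec_wp; last by []; rewrite /= /upd /=; wp_step addn0.
Qed.

End Program.

(** * Counting coin sequences *)

(** The sum of [f] over bit strings of length [T], by recursion, so that blocks of coins split off
    without tuple types. *)
Fixpoint bsum (T : nat) (f : seq bool -> nat) : nat :=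
  if T is T'.+1
  then bsum T' (fun r => f (true :: r)) + bsum T' (fun r => f (false :: r))
  else f [::].

Lemma sum_tupleE T (f : seq bool -> nat) :
  \sum_(r : T.-tuple bool) f r = bsum T f.
Proof.
elim: T f => [|T IH] f.
  by rewrite (big_pred1 [tuple]) // => r; rewrite [r]tuple0; apply/esym/eqP.
rewrite /= -!IH (reindex (fun p : bool * T.-tuple bool => [tuple of p.1 :: p.2])) /=.
  rewrite -(pair_bigA _ (fun b r => f (b :: tval r))) /=.
  by rewrite big_bool.
exists (fun r : T.+1.-tuple bool => (thead r, [tuple of behead r])).
  by move=> [b r] _ /=; congr (_, _); apply: val_inj.
by move=> r _; rewrite [r in RHS]tuple_eta.
Qed.

Lemma eq_bsum T f g : (forall r, size r = T -> f r = g r) -> bsum T f = bsum T g.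
Proof.
elim: T f g => [|T IH] f g fg /=; first exact: fg.
by congr (_ + _); apply: IH => r rT; apply: fg; rewrite /= rT.
Qed.

Lemma bsum_cat a b f :
  bsum (a + b) f = bsum a (fun x => bsum b (fun y => f (x ++ y))).
Proof. by elim: a f => [|a IH] f //=; rewrite !IH. Qed.

Lemma bsumMl T c f : bsum T (fun r => c * f r) = c * bsum T f.
Proof. by elim: T f => [|T IH] f //=; rewrite !IH mulnDr. Qed.

Lemma bsumMr T c f : bsum T (fun r => f r * c) = bsum T f * c.
Proof. by elim: T f => [|T IH] f //=; rewrite !IH mulnDl. Qed.

Lemma bsum1 T : bsum T (fun=> 1) = 2 ^ T.
Proof. by elim: T => //= T ->; rewrite expnS mul2n addnn. Qed.

(** Read in binary, [L] bits take each value below 2^L exactly once; the accumulator [a] serves the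
    induction. *)
Lemma bsum_bits_val L a (F : nat -> nat) :
  bsum L (fun x => F (bits_val a x)) = \sum_(i < 2 ^ L) F (a * 2 ^ L + i).
Proof.
elim: L a => [|L IH] a /=; first by rewrite big_ord1 muln1 addn0.
rewrite (IH (a + a + true)) (IH (a + a + false)) addnC.
rewrite expnS mul2n -addnn big_split_ord /=.
by congr (_ + _); apply: eq_bigr => i _; congr F; rewrite /=; nia.
Qed.

(** * Counting the coin sequences that miss a set *)

Section Draws.
Variables (n L : nat) (W : {set 'I_n}).
Hypothesis L_ge : n <= 2 ^ L.

Definition hits (a : nat) := a \in [seq val v | v in W].

Definition misses j (cs : seq bool) := all (predC hits) (draws n L j cs).

(** Draws use disjoint blocks of [L] coins, so their counts multiply; the last [T] coins are
    free. *)
Lemma bsum_misses j T :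
  bsum (j * L + T) (misses j)
    = (\sum_(i < 2 ^ L) ~~ hits (i %% n)) ^ j * 2 ^ T.
Proof.
elim: j => [|j IH]; first by rewrite expn0 mul1n -bsum1.
rewrite mulSn -addnA bsum_cat expnS -mulnA -IH.
have -> : \sum_(i < 2 ^ L) ~~ hits (i %% n)
    = bsum L (fun x => ~~ hits (bits_val 0 x %% n)).
  by rewrite (bsum_bits_val L 0 (fun a => ~~ hits (a %% n))); apply: eq_bigr.
rewrite -bsumMr; apply: eq_bsum => x xL; rewrite -bsumMl; apply: eq_bsum => y _.
rewrite /misses /= take_cat drop_cat xL ltnn subnn take0 drop0 cats0.
by case: (hits _) => /=; rewrite ?mul0n ?mul1n.
Qed.

(** Each vertex v of [W] is hit at least by the value v itself, since v < n <= 2^L. *)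
Lemma sum_not_hits : \sum_(i < 2 ^ L) ~~ hits (i %% n) <= 2 ^ L - #|W|.
Proof.
have E : 2 ^ L = \sum_(i < 2 ^ L) (hits (i %% n) + ~~ hits (i %% n)).
  rewrite (eq_bigr (fun=> 1)) ?sum_nat_const ?card_ord ?muln1 //.
  by move=> i _; case: (hits _).
rewrite [X in _ <= X - _]E big_split /=.
suff : #|W| <= \sum_(i < 2 ^ L) hits (i %% n).
  by move=> H; rewrite -addnBAC // leq_addl.
have -> : #|W| = \sum_(i < n) hits (i %% n).
  rewrite -sum1_card big_mkcond; apply: eq_bigr => v _ /=.
  rewrite modn_small // /hits mem_map ?mem_enum; last exact: val_inj.
  by case: (v \in W).
rewrite -(big_mkord xpredT (fun i => nat_of_bool (hits (i %% n)))).
rewrite -(big_mkord xpredT (fun i => nat_of_bool (hits (i %% n)))).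
by rewrite [X in _ <= X](big_cat_nat (n := n)) //= leq_addr.
Qed.

End Draws.

Lemma bernoulli_expn x d m : x ^ m.+1 + m.+1 * d * x ^ m <= (x + d) ^ m.+1.
Proof.
elim: m => [|m IH]; first by rewrite !expn1 expn0; lia.
rewrite [(x + d) ^ _]expnS; apply: leq_trans (leq_mul (leqnn (x + d)) IH).
by rewrite !expnS; move: (x ^ m) => y; nia.
Qed.

(** Events of probability d / N >= 1 / m are all missed in m independent trials with probability at
    most 1/2: Bernoulli's inequality for N = (N - d) + d. *)
Lemma half_expn N d m : d <= N -> N <= m * d -> 0 < m ->
  2 * (N - d) ^ m <= N ^ m.
Proof.
move=> dN Nmd; case: m Nmd => // m Nmd _.
have := bernoulli_expn (N - d) d m; rewrite subnK //.
apply: leq_trans; rewrite mul2n -addnn leq_add2l expnS.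
by apply: leq_mul => //; lia.
Qed.

Lemma leq_expn m a b : a <= b -> a ^ m <= b ^ m.
Proof. by case: m => // m ab; rewrite leq_exp2r. Qed.

(** * Union bound over all balls *)

Section Spread.
Variables (n L q T : nat) (e : rel 'I_n).
Hypothesis e_sym : symmetric e.
Hypothesis n_gt0 : 0 < n.
Hypothesis q_gt0 : 0 < q.
Hypothesis L_ge : n <= 2 ^ L.
Hypothesis L_lt : 2 ^ L < 2 * n.
Hypothesis T_ge : 6 * q * L * L <= T.

(* The pair (x, r) stands for the ball of center x and radius r. *)
Definition outside (p : 'I_n * 'I_n) := [set v | p.2 < graph_dist e p.1 v].

(** Radii below n suffice, since nothing lies outside a ball of radius n or more; this leaves n^2
    pairs. *)
Definition spreads (cs : seq bool) : bool :=
  [forall p, (n < #|outside p| * q) ==> ~~ misses L (outside p) (6 * q * L) cs].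

Lemma spreads_spread cs : spreads cs -> spread e q (drawn n L (6 * q * L) cs).
Proof.
move=> /forallP sp x r Hr; rewrite leqNgt; apply/negP => big.
have [rn|nr] := ltnP r n; last first.
  move: big; rewrite (_ : [set v | _] = set0) ?cards0 ?mul0n //.
  apply/setP => v; rewrite !inE ltnNge (leq_trans _ nr) //.
  by have := graph_dist_le_card e x v; rewrite card_ord.
have := sp (x, Ordinal rn); rewrite big /= => /negP; apply.
apply/allP => a aD; apply/negP => /mapP[v]; rewrite mem_enum inE /= => xv av.
have vD : v \in drawn n L (6 * q * L) cs by rewrite inE; move: aD; rewrite av.
have := Hr v vD.
by rewrite (graph_dist_sym e_sym) leqNgt xv.
Qed.

(* Each of the 3 * L groups of 2 * q draws misses the set with probability at *)
(* most 1 / 2.                                                                *)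
Lemma card_misses p : n < #|outside p| * q ->
  n ^ 3 * bsum T (misses L (outside p) (6 * q * L)) <= 2 ^ T.
Proof.
move=> big; set W := outside p in big *; set N := 2 ^ L.
have WN : #|W| <= N.
  by apply: leq_trans L_ge; rewrite -[X in _ <= X]card_ord max_card.
rewrite -(subnKC T_ge) bsum_misses // expnD mulnA leq_pmul2r ?expn_gt0 //.
have -> : 2 ^ (6 * q * L * L) = (N ^ (2 * q)) ^ (3 * L).
  by rewrite -!expnM; congr (_ ^ _); lia.
apply: leq_trans (_ : (2 * (N - #|W|) ^ (2 * q)) ^ (3 * L) <= _).
  have -> : (2 * (N - #|W|) ^ (2 * q)) ^ (3 * L)
      = N ^ 3 * (N - #|W|) ^ (6 * q * L).
    rewrite expnMn -!expnM [L * 3]mulnC; congr (_ * _ ^ _); lia.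
  apply: leq_mul; first exact: leq_expn.
  by apply: leq_expn; exact: sum_not_hits.
apply: leq_expn; apply: half_expn => //; last by lia.
(* Here N <= 2 n <= 2 q |W|, as [half_expn] requires. *)
apply: leq_trans (ltnW L_lt) _; rewrite mulnAC -mulnA leq_pmul2l //; lia.
Qed.

(** Union bound: each of at most n^2 pairs is responsible for at most 2^T / n^3 bad coin
    sequences. *)
Lemma card_not_spreads :
  n * #|[set r : T.-tuple bool | ~~ spreads r]| <= 2 ^ T.
Proof.
have -> : #|[set r : T.-tuple bool | ~~ spreads r]|
    = \sum_(r : T.-tuple bool) ~~ spreads r.
  rewrite -sum1_card big_mkcond; apply: eq_bigr => r _; rewrite inE.
  by case: (spreads r).
pose bad p := n < #|outside p| * q.
pose m p (r : seq bool) : nat := misses L (outside p) (6 * q * L) r.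
have le (r : T.-tuple bool) : ~~ spreads r <= \sum_(p | bad p) m p r.
  case: (boolP (spreads r)) => // /forallPn[p].
  rewrite negb_imply negbK => /andP[bp mp].
  by rewrite (bigD1 p) //= /m mp.
rewrite -(@leq_pmul2l (n ^ 2)) ?expn_gt0 ?n_gt0 // mulnA -expnSr.
have le_sum : \sum_(r : T.-tuple bool) ~~ spreads r
    <= \sum_(r : T.-tuple bool) \sum_(p | bad p) m p r by exact: leq_sum.
apply: leq_trans (leq_mul (leqnn (n ^ 3)) le_sum) _.
rewrite exchange_big big_distrr /=.
apply: leq_trans (_ : \sum_(p | bad p) 2 ^ T <= _).
  by apply: leq_sum => p bp; rewrite sum_tupleE; exact: card_misses.
rewrite sum_nat_const leq_mul // -mulnn.
by apply: leq_trans (max_card _) _; rewrite card_prod card_ord.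
Qed.

End Spread.

(** * Radius and Helly property *)

Section Radius.
Variables (T : finType) (e : rel T).
Local Notation ecc v := (\max_(u : T) graph_dist e u v).

Lemma graph_radius_le v : graph_radius e <= ecc v.
Proof.
have H (F : T -> nat) m r : v \in r -> \big[minn/m]_(x <- r) F x <= F v.
  elim: r => // x r IH; rewrite inE big_cons => /orP[/eqP ->|/IH le].
    exact: geq_minl.
  exact: leq_trans (geq_minr _ _) le.
exact: (H (fun v => ecc v)) (mem_index_enum v).
Qed.

Lemma graph_radius_ge m : m <= #|T| -> (forall v, m <= ecc v) ->
  m <= graph_radius e.
Proof.
move=> mT mecc; rewrite /graph_radius.
by elim/big_ind: _ => // x y mx my; rewrite leq_min mx my.
Qed.

Lemma graph_radius_center : 0 < #|T| ->
  exists c, forall u, graph_dist e u c <= graph_radius e.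
Proof.
move=> /card_gt0P[o _].
case: (arg_minnP (fun v => ecc v) (isT : xpredT o)) => c _ cmin.
exists c => u; apply: leq_trans (_ : ecc c <= _).
  exact: (@leq_bigmax _ (fun u => graph_dist e u c)).
apply: graph_radius_ge => [|v]; last exact: cmin.
by apply/bigmax_leqP => v _; exact: graph_dist_le_card.
Qed.

Lemma k_helly_witness k : symmetric e -> 0 < #|T| -> 0 < k -> k_helly e k ->
  exists2 B : {set T}, #|B| <= k
    & forall x, exists2 b, b \in B & graph_radius e <= graph_dist e b x.
Proof.
move=> es /card_gt0P[o _] k0 helly; case Er: (graph_radius e) => [|r].
  by exists [set o]; [rewrite cards1 | move=> x; exists o; rewrite ?inE].
have rT : r < #|T|.
  rewrite -Er; apply: leq_trans (graph_radius_le o) _.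
  by apply/bigmax_leqP => v _; exact: graph_dist_le_card.
pose F := [set graph_ball e v r | v : T].
have [/existsP[S /and3P[SF Sk /eqP S0]]|noS] := boolP [exists S : {set {set T}},
    [&& S \subset F, #|S| <= k & \bigcap_(A in S) A == set0]].
  pose cen (A : {set T}) := odflt o [pick v | graph_ball e v r == A].
  exists (cen @: S); first exact: leq_trans (leq_imset_card _ _) Sk.
  move=> x; have : x \notin \bigcap_(A in S) A by rewrite S0 inE.
  have [/existsP[A /andP[AS xA]] _|all_in] :=
      boolP [exists A : {set T}, (A \in S) && (x \notin A)]; last first.
    case/negP; apply/bigcapP => A AS; apply: contraNT all_in => xA.
    by apply/existsP; exists A; rewrite AS.
  exists (cen A); first exact: imset_f.
  have cenA : graph_ball e (cen A) r = A.
    rewrite /cen; case: pickP => [v /eqP //|none].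
    have /imsetP[v _ Av] := subsetP SF A AS.
    by have := none v; rewrite -Av eqxx.
  rewrite (graph_dist_sym es) ltnNge; apply: contra xA => le.
  (* As r < #|T|, a distance at most [r] is finite, which settles the connectivity guard of the
     ball. *)
  rewrite -cenA inE le andbT -graph_dist_ltE; exact: leq_ltn_trans rT.
have /set0Pn[x /bigcapP xF] : \bigcap_(A in F) A != set0.
  apply: helly => [A /imsetP[v _ ->]|S SF Sk]; first by exists v, r.
  apply: contra noS => S0; apply/existsP; exists S.
  by rewrite SF Sk.
suff : ecc x <= r by move/(leq_trans (graph_radius_le x)); rewrite Er ltnn.
apply/bigmax_leqP => u _; rewrite (graph_dist_sym es).
have : x \in graph_ball e u r by apply: xF; exact: imset_f.
by rewrite inE => /andP[].
Qed.

(** Every other vertex is infinitely far from [v], and such a vertex exists, so [v] has infinite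
    eccentricity as well. *)
Lemma isolated_radius v : symmetric e -> 1 < #|T| -> (forall y, ~~ e v y) ->
  graph_radius e = #|T|.
Proof.
move=> es T1 iso; apply/eqP; rewrite eqn_leq; apply/andP; split.
  apply: leq_trans (graph_radius_le v) _.
  by apply/bigmax_leqP => u _; exact: graph_dist_le_card.
have far_v c : c != v -> #|T| <= graph_dist e v c.
  move=> cv; rewrite leqNgt; apply/negP => /graph_dist_path[[|y p] [/=]].
    by move=> _ vc; rewrite vc eqxx in cv.
  by rewrite (negPf (iso y)).
apply: graph_radius_ge => // c.
have [->|cv] := eqVneq c v; last first.
  apply: leq_trans (far_v c cv) _.
  exact: (@leq_bigmax _ (fun u => graph_dist e u c)).
have [u uv] : exists u, u != v.
  have : 0 < #|[set~ v]| by rewrite cardsC1; lia.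
  by case/card_gt0P => u; rewrite !inE; exists u.
apply: leq_trans (far_v u uv) _; rewrite (graph_dist_sym es).
exact: (@leq_bigmax _ (fun u => graph_dist e u v)).
Qed.

(** An edge {a, b} comes only from the ordered pairs (a, b) and (b, a). *)
Lemma card_edges_le : irreflexive e ->
  #|[set p : T * T | e p.1 p.2]| <= 2 * #|edge_set e|.
Proof.
move=> ei; set S := [set p | _].
pose f (p : T * T) := [set p.1; p.2].
have -> : edge_set e = f @: S.
  by apply/setP => A; apply/imsetP/imsetP => -[p]; rewrite ?inE => pS ->;
    exists p; rewrite ?inE.
rewrite -[#|S|]sum1_card (partition_big_imset f) /= mulnC -sum_nat_const.
apply: leq_sum => A /imsetP[[a b]]; rewrite inE /= => eab ->.
rewrite sum1_card.
apply: leq_trans (_ : #|[set (a, b); (b, a)]| <= 2); last first.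
  by rewrite cards2; case: eqP.
apply: subset_leq_card; apply/subsetP => -[c d].
rewrite !inE /= => /andP[ecd /eqP /setP E].
have cd : c != d by apply/eqP => E'; rewrite inE /= E' ei in ecd.
have := E c; have := E d; rewrite !inE !eqxx /= ?orbT /f /=.
rewrite !xpair_eqE => /esym/orP[/eqP d1|/eqP d1] /esym/orP[/eqP c1|/eqP c1];
  by move: cd; rewrite d1 c1 !eqxx ?orbT.
Qed.

End Radius.

(** * Memory layout of the input *)

Section Input.
Variables (n : nat) (e : rel 'I_n) (adj : 'I_n -> seq 'I_n) (k : nat).
Hypothesis adjP : adjacency_lists e adj.

Local Notation lists := [seq [seq val u | u <- adj v] | v <- enum 'I_n].
Local Notation input := (graph_input e adj k).

Definition tot_deg := \sum_(v : 'I_n) size (adj v).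

Definition offset (i : nat) := sumn (take i (shape lists)).

Lemma size_lists : size (shape lists) = n.
Proof. by rewrite size_map size_map size_enum_ord. Qed.

Lemma nth_lists (v : 'I_n) : nth [::] lists v = [seq val u | u <- adj v].
Proof. by rewrite (nth_map v) ?size_enum_ord // nth_ord_enum. Qed.

Lemma offset_n : offset n = tot_deg.
Proof.
rewrite /offset take_oversize ?size_lists // /tot_deg sumnE /shape -map_comp.
rewrite big_map big_enum /=; apply: eq_bigr => v _; exact: size_map.
Qed.

Lemma size_flatten_lists : size (flatten lists) = tot_deg.
Proof. by rewrite size_flatten -offset_n /offset take_oversize ?size_lists. Qed.

Lemma offsetS (v : 'I_n) : offset v.+1 = offset v + size (adj v).
Proof.
rewrite /offset (take_nth 0) ?size_lists // sumn_rcons; congr (_ + _).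
rewrite (nth_map [::]); first by rewrite nth_lists size_map.
by rewrite size_map size_enum_ord.
Qed.

Lemma offset_le i : offset i <= tot_deg.
Proof.
rewrite -offset_n /offset (take_oversize (n := n)) ?size_lists //.
by rewrite -{2}(cat_take_drop i (shape lists)) sumn_cat leq_addr.
Qed.

Lemma nth_flatten_offset (T : Type) (x0 : T) (ss : seq (seq T)) i j :
  j < size (nth [::] ss i) ->
  nth x0 (flatten ss) (sumn (take i (shape ss)) + j) = nth x0 (nth [::] ss i) j.
Proof.
elim: ss i => [|s ss IH] [|i] //= ji; rewrite nth_cat ?add0n ?ji //.
by rewrite -addnA ltnNge leq_addr /= addKn IH.
Qed.

Lemma input_n : nth 0 input 0 = n. Proof. by []. Qed.

Lemma input_k : nth 0 input 2 = k. Proof. by []. Qed.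

Lemma nth_cat3 (a b c : nat) s i : nth 0 ([:: a; b; c] ++ s) (3 + i) = nth 0 s i.
Proof. by []. Qed.

Lemma input_offset i : i <= n -> nth 0 input (3 + i) = offset i.
Proof.
move=> i_n; rewrite /graph_input nth_cat3.
by rewrite nth_cat size_map size_iota ltnS i_n (nth_map 0) ?size_iota ?nth_iota.
Qed.

Lemma input_adj j : nth 0 input (4 + n + j) = nth 0 (flatten lists) j.
Proof.
rewrite -[4 + n + j]/(3 + (n.+1 + j)) /graph_input nth_cat3.
by rewrite nth_cat size_map size_iota ltnNge leq_addr /= addKn.
Qed.

Lemma tot_deg_le_sqr : tot_deg <= n * n.
Proof.
apply: leq_trans (_ : \sum_(v : 'I_n) n <= _); last first.
  by rewrite sum_nat_const card_ord.
apply: leq_sum => v _; have [/card_uniqP <- _] := adjP v.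
by rewrite -[X in _ <= X]card_ord max_card.
Qed.

Lemma tot_deg_le_edges : irreflexive e -> tot_deg <= 2 * #|edge_set e|.
Proof.
move=> ei; apply: leq_trans (card_edges_le ei).
rewrite -sum1_card (eq_bigl (fun p : 'I_n * 'I_n => true && e p.1 p.2)); last first.
  by move=> p; rewrite inE.
rewrite -(pair_big_dep xpredT (fun v u => e v u) (fun _ _ => 1)) /=.
apply: leq_sum => v _; rewrite sum1_card; have [/card_uniqP <- E] := adjP v.
by apply: subset_leq_card; apply/subsetP => u; rewrite E.
Qed.

Section Word.
Variable w : nat.
Hypothesis w_large : 20 + 20 * n + tot_deg + k < 2 ^ w.

Definition input_mem (a : nat) := nth 0 input a %% 2 ^ w.

Lemma input_mem_n : input_mem 0 = n.
Proof. by rewrite /input_mem input_n modn_small //; lia. Qed.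

Lemma input_mem_k : input_mem 2 = k.
Proof. by rewrite /input_mem input_k modn_small //; lia. Qed.

Lemma input_mem_offset i : i <= n -> input_mem (3 + i) = offset i.
Proof.
move=> i_n; rewrite /input_mem input_offset // modn_small //.
by have := offset_le i; lia.
Qed.

Lemma input_mem_offsetS (v : 'I_n) :
  input_mem (3 + v + 1) = input_mem (3 + v) + size (adj v).
Proof.
have vn := ltn_ord v.
by rewrite -addnA addn1 !input_mem_offset ?offsetS // ltnW.
Qed.

Lemma input_mem_adj (v : 'I_n) j : j < size (adj v) ->
  input_mem (input_mem (3 + v) + (4 + n) + j) = nth v (adj v) j.
Proof.
move=> jv; rewrite input_mem_offset; last exact: ltnW.
rewrite [offset v + _]addnC -addnA /input_mem input_adj nth_flatten_offset.
  rewrite nth_lists (nth_map v) // modn_small //=.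
  by have := ltn_ord (nth v (adj v) j); lia.
by rewrite nth_lists size_map.
Qed.

Lemma input_mem_offset_le (v : 'I_n) : input_mem (3 + v) + size (adj v) <= tot_deg.
Proof.
by rewrite input_mem_offset ?(ltnW (ltn_ord v)) // -offsetS offset_le.
Qed.

Lemma input_mem_tot : input_mem (3 + n) = tot_deg.
Proof. by rewrite input_mem_offset // offset_n. Qed.

Lemma input_mem_out a : 4 + n + tot_deg <= a -> input_mem a = 0.
Proof.
move=> la; rewrite /input_mem -(subnKC (leq_trans (leq_addr _ _) la)).
by rewrite input_adj nth_default ?mod0n // size_flatten_lists; lia.
Qed.

End Word.

(** Fewer than n adjacency entries leave some list empty, hence some vertex isolated. *)
Lemma tot_deg_sparse : symmetric e -> 1 < n -> tot_deg < n -> graph_radius e = n.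
Proof.
move=> es n1 tn.
have [/existsP[v /eqP v0]|all_pos] := boolP [exists v, size (adj v) == 0].
  have := @isolated_radius _ e v es; rewrite card_ord; apply=> // y.
  have [_ E] := adjP v; have := E y; rewrite (size0nil v0) in_nil.
  by rewrite -[e v y]/(y \in e v) => <-.
suff : n <= tot_deg by lia.
rewrite -{1}[n]card_ord -sum1_card; apply: leq_sum => v _.
by rewrite lt0n; apply: contra all_pos => v0; apply/existsP; exists v.
Qed.

End Input.

(** * Running the program on a graph input *)

Lemma runs_outputs_within w prog input cs T T' out :
  spec w prog (State (fun=> 0) (fun a => nth 0 input a %% 2 ^ w) cs) T'
    (fun s => regs s 0 = out) ->
  T' <= T -> outputs_within w prog input T out cs.
Proof.
move=> [t [s' [tT r so]]] TT; rewrite /outputs_within /init.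
rewrite -(subnK (leq_trans tT TT)) iterD (iter_step_runs r).
suff -> : forall j, iter j (step w) ([::], s') = ([::], s') by rewrite /= so eqxx.
by elim=> //= j ->.
Qed.

(** From k n <= q^2 and k <= n follow k <= q and k (n / q) <= q: the rounds cost O(q) searches, and
    the 6 q L draws dominate. *)
Lemma radius_time k n q L sz : 1 < n -> k <= n -> 0 < k -> n < sz ->
  k * n <= q * q -> 0 < q -> 0 < L <= n ->
  k.+1 * ((150 + 110 * (n %/ q)) * sz + 1) + 6 * q * L * (8 * L + 110 * sz + 1)
    + 20 * n + 200 <= 2000 * (q * L * sz).
Proof.
move=> n1 kn k0 nsz kq q0 /andP[L0 Ln].
have k_q : k <= q by nia.
have kd : k * (n %/ q) <= q.
  rewrite -(leq_pmul2r q0) -mulnA; apply: leq_trans kq.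
  by rewrite leq_mul2l leq_divM orbT.
have t1 : k.+1 * ((150 + 110 * (n %/ q)) * sz + 1) <= 522 * (q * sz).
  move: (n %/ q) kd => d kd.
  have h1 : k.+1 <= 2 * q by lia.
  have h2 : k.+1 * d <= 2 * q by nia.
  have h3 : k.+1 * sz <= 2 * q * sz by rewrite leq_mul2r h1 orbT.
  have h4 : k.+1 * d * sz <= 2 * q * sz by rewrite leq_mul2r h2 orbT.
  have h5 : k.+1 <= k.+1 * sz by rewrite leq_pmulr //; lia.
  lia.
have t2 : 6 * q * L * (8 * L + 110 * sz + 1) <= 714 * (q * L * sz).
  have h : 8 * L + 110 * sz + 1 <= 119 * sz by lia.
  have := leq_mul (leqnn (6 * q * L)) h; lia.
have t3 : q * sz <= q * L * sz by rewrite mulnAC leq_pmulr.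
have t4 : sz <= q * sz by rewrite leq_pmull.
lia.
Qed.

Section Run.
Variables (k n : nat) (e : rel 'I_n) (adj : 'I_n -> seq 'I_n) (w : nat).
Hypothesis k_ge2 : 2 <= k.
Hypothesis n_ge2 : 2 <= n.
Hypothesis e_sym : symmetric e.
Hypothesis e_helly : k_helly e k.
Hypothesis adjP : adjacency_lists e adj.
Hypothesis w_ge : (n + k) ^ 8 <= 2 ^ w.

(** As n + k >= 4, six of the eight factors n + k give 4096, which absorbs the constants. *)
Lemma word_large : 20 + 20 * n + tot_deg adj + 6 * (n * n) + k < 2 ^ w.
Proof.
apply: leq_trans w_ge; have := tot_deg_le_sqr adjP; move: (tot_deg adj) => tot le.
have nk : 4 <= n + k by lia.
have h2 : 4 ^ 6 <= (n + k) ^ 6 by exact: leq_expn.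
have -> : (n + k) ^ 8 = (n + k) ^ 6 * ((n + k) * (n + k)).
  by rewrite mulnn -expnD.
apply: leq_trans (leq_mul h2 (leqnn _)).
have h3 : n * n <= (n + k) * (n + k) by apply: leq_mul; exact: leq_addr.
have h4 : n + k <= (n + k) * (n + k) by rewrite leq_pmulr //; lia.
have -> : 4 ^ 6 = 4096 by [].
lia.
Qed.

Lemma run_sparse T (cs : seq bool) : tot_deg adj < n -> 20 <= T ->
  outputs_within w radius_prog (graph_input e adj k) T (graph_radius e) cs.
Proof.
move=> tn T20; have W := word_large.
have W' : 20 + 20 * n + tot_deg adj + k < 2 ^ w by lia.
apply: runs_outputs_within T20; rewrite (tot_deg_sparse adjP) //.
apply: (radius_prog_sparse (M0 := input_mem e adj k w) (tot := tot_deg adj)) => //.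
- by lia.
- exact: input_mem_n.
- exact: input_mem_tot.
Qed.

Lemma run_dense q L T (cs : seq bool) : n <= tot_deg adj ->
  minn k n * n <= q * q -> q.-1 * q.-1 < minn k n * n ->
  n <= 2 ^ L -> 2 ^ L < 2 * n -> 0 < q -> 0 < L <= n ->
  2000 * (q * L * (n + tot_deg adj + 1)) <= T -> size cs = T ->
  spreads L q e cs ->
  outputs_within w radius_prog (graph_input e adj k) T (graph_radius e) cs.
Proof.
move=> nt q1 q2 L1 L2 q0 L0 TT csT sp; have W := word_large.
have W' : 20 + 20 * n + tot_deg adj + k < 2 ^ w by lia.
have cardI : 0 < #|'I_n| by rewrite card_ord; lia.
have [B Bk Bfar] := k_helly_witness e_sym cardI (ltnW k_ge2) e_helly.
have Bn : #|B| <= n by rewrite -[X in _ <= X]card_ord max_card.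
have n0 : 0 < n by lia.
have k0 : 0 < k by lia.
have adjE v : adj v =i e v by case: (adjP v).
have k'n : minn k n <= n := geq_minr _ _.
have k'0 : 0 < minn k n by lia.
have szn : n < n + tot_deg adj + 1 by lia.
have time := radius_time n_ge2 k'n k'0 szn q1 q0 L0.
apply: runs_outputs_within (leq_trans time TT).
apply: (radius_prog_spec (M0 := input_mem e adj k w) (tot := tot_deg adj)
          (adj := adj)) => //.
- by move=> v; exact: input_mem_offsetS.
- by move=> v j; exact: input_mem_adj.
- by move=> v; exact: input_mem_offset_le.
- by lia.
- exact: graph_radius_center.
- by rewrite leq_min Bk Bn.
- exact: input_mem_n.
- exact: input_mem_k.
- exact: input_mem_tot.
- exact: input_mem_out.
- rewrite /= csT; apply: leq_trans TT.
  have : L <= n + tot_deg adj + 1 by lia.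
  move: (n + _ + 1) => z Lz.
  have := leq_mul (leqnn (q * L)) Lz; lia.
- exact: spreads_spread.
Qed.

End Run.

Lemma sqrt_up_exists m :
  exists q, m <= q * q /\ (0 < m -> 0 < q /\ q.-1 * q.-1 < m).
Proof.
have ex : exists q, m <= q * q by exists m; nia.
case: (ex_minnP ex) => q mq qmin; exists q; split=> // m0.
have q0 : 0 < q by case: q mq {qmin} => //; lia.
by split=> //; rewrite ltnNge; apply/negP => /qmin; lia.
Qed.

Lemma log_up_exists n : 1 < n ->
  exists L, [/\ n <= 2 ^ L, 2 ^ L < 2 * n & 0 < L <= n].
Proof.
move=> n1; have ex : exists L, n <= 2 ^ L by exists n; exact/ltnW/ltn_expl.
case: (ex_minnP ex) => -[|L] nL Lmin; first by rewrite expn0 in nL; lia.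
have lt : 2 ^ L < n by rewrite ltnNge; apply/negP => /Lmin; lia.
exists L.+1; split=> //; first by rewrite expnS; lia.
by have := ltn_expl L (isT : 1 < 2); lia.
Qed.

(** * Probability and real bounds *)

Unset Implicit Arguments.

Import Order.TTheory GRing.Theory Num.Theory.

Local Open Scope ring_scope.

Lemma prob_outputs_ge (R : realType) w prog input T out n
    (good : T.-tuple bool -> bool) : (0 < n)%N ->
  (n * #|[set r : T.-tuple bool | ~~ good r]| <= 2 ^ T)%N ->
  (forall r, good r -> outputs_within w prog input T out r) ->
  1 - (n%:R `^ 1)^-1 <= prob_outputs_within R w prog input T out.
Proof.
move=> n0 bad ok; rewrite powRr1 ?ler0n // /prob_outputs_within.
set A := [set r : T.-tuple bool | _]; set B := [set r | _] in bad.
have AB : (2 ^ T <= #|A| + #|B|)%N.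
  have <- : #|{: T.-tuple bool}| = (2 ^ T)%N by rewrite card_tuple card_bool.
  have -> : #|{: T.-tuple bool}| = #|A :|: B|.
    apply: eq_card => r; rewrite !inE; case: (boolP (good r)) => [/ok ->//|].
    by rewrite orbT.
  by rewrite cardsU leq_subr.
have T0 : 0 < (2 ^ T)%:R :> R by rewrite ltr0n expn_gt0.
have n0' : 0 < n%:R :> R by rewrite ltr0n.
rewrite ler_pdivlMr // mulrBl mul1r lerBlDr.
apply: le_trans (_ : (#|A|%:R + #|B|%:R : R) <= _).
  by rewrite -natrD ler_nat.
by rewrite lerD2l mulrC ler_pdivlMr // mulrC -natrM ler_nat.
Qed.

(** Rounding up the root of a positive integer at most doubles it. *)
Lemma sqrt_up_le (R : realType) (q m : nat) : (0 < m)%N -> (q.-1 * q.-1 < m)%N ->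
  q%:R <= 2 * Num.sqrt m%:R :> R.
Proof.
move=> m0 qm; have q4 : (q * q <= 4 * m)%N by nia.
have -> : 2 * Num.sqrt m%:R = Num.sqrt (4 * m)%:R :> R.
  rewrite natrM sqrtrM ?ler0n //; congr (_ * _).
  by rewrite -[4%N]/(2 ^ 2)%N natrX sqrtr_sqr ger0_norm ?ler0n.
have -> : q%:R = Num.sqrt (q * q)%:R :> R.
  by rewrite mulnn natrX sqrtr_sqr ger0_norm ?ler0n.
by rewrite ler_wsqrtr // ler_nat.
Qed.

(** Since n >= 2, we have 2^L < 2 n <= n^2. *)
Lemma log_up_le (R : realType) (L n : nat) : (1 < n)%N -> (2 ^ L < 2 * n)%N ->
  L%:R * ln 2 <= 2 * ln n%:R :> R.
Proof.
move=> n1 Ln; have n0 : 0 < n%:R :> R by rewrite ltr0n; lia.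
have -> : L%:R * ln 2 = ln ((2 ^ L)%:R) :> R.
  by rewrite natrX lnXn ?ltr0n // mulr_natl.
have -> : 2 * ln n%:R = ln ((n ^ 2)%:R) :> R.
  by rewrite natrX lnXn // mulr_natl.
by rewrite ler_ln ?posrE ?ltr0n ?expn_gt0 //; [rewrite ler_nat; nia | lia].
Qed.

Theorem theorem3 (R : realType) :
  exists (prog : cmd) (b a : nat) (C c' : R),
    0 < c' /\
    forall (k n : nat) (e : rel 'I_n) (adj : 'I_n -> seq 'I_n) (w : nat),
      (2 <= k)%N -> (0 < n)%N ->
      symmetric e -> irreflexive e -> k_helly e k ->
      adjacency_lists e adj ->
      ((n + k) ^ b <= 2 ^ w)%N ->
      exists T : nat,
        T%:R <= C * (maxn #|edge_set e| 1)%:R * Num.sqrt (k * n)%:R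
                  * ln n%:R ^+ a /\
        1 - (n%:R `^ c')^-1
          <= prob_outputs_within R w prog (graph_input e adj k) T (graph_radius e).
Proof.
(* 2000 comes from [radius_time]; 24 / ln 2 is the product of the factors 2, 2 / ln 2 and 6 in the
   bounds [qR], [LR] and [szR]. *)
exists radius_prog, 8, 1%N, (2000 * 24 / ln 2), 1; split=> //.
move=> k n e adj w k2 n0 es ei eh adjP wk; rewrite expr1.
have [n1|n1] := leqP n 1.
  have nE : n%:R = 1 :> R by rewrite (_ : n = 1%N) //; lia.
  (* For n = 1 the time bound vanishes with ln 1, and the required probability is 1 - 1 = 0. *)
  exists 0%N; rewrite nE ln1 mulr0 powR1 invr1 subrr; split=> //.
  by rewrite divr_ge0 ?ler0n.
have ln2 : 0 < ln 2 :> R by rewrite ln_gt0 // ltr1n.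
have lnn : ln 2 <= ln n%:R :> R.
  by rewrite ler_ln ?posrE ?ltr0n // ler_nat.
have sq1 : 1 <= Num.sqrt (k * n)%:R :> R.
  by rewrite -[X in X <= _]sqrtr1 ler_wsqrtr // ler1n; nia.
have [tn|nt] := ltnP (tot_deg adj) n.
  exists 20; split; last first.
    apply: (@prob_outputs_ge R w radius_prog _ 20 _ n xpredT) => // [|r _].
      by rewrite (_ : [set r | _] = set0) ?cards0 ?muln0 //; apply/setP => r; rewrite !inE.
    exact: run_sparse.
  have m1 : 1 <= (maxn #|edge_set e| 1)%:R :> R by rewrite ler1n leq_maxr.
  (* As ln n >= ln 2, the time bound is at least 48000, well above 20. *)
  apply: (@le_trans _ _ (2000 * 24 / ln 2 * 1 * 1 * ln 2)).
    by rewrite !mulr1 divfK ?gt_eqF // -natrM ler_nat; lia.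
  have C0 : 0 <= 2000 * 24 / ln 2 :> R by rewrite divr_ge0 ?mulr_ge0 ?ler0n // ltW.
  move: (2000 * 24 / ln 2) C0 => C C0.
  apply: ler_pM => //; [by rewrite !mulr1 | exact: ltW |].
  by apply: ler_pM => //; [rewrite mulr1 | exact: ler_wpM2l].
have [q [q1 q2]] := sqrt_up_exists (minn k n * n).
have [|q0 {}q2] := q2; first by rewrite muln_gt0; lia.
have [L [L1 L2 L0]] := log_up_exists n1.
pose T := (2000 * (q * L * (n + tot_deg adj + 1)))%N.
exists T; split; last first.
  apply: (@prob_outputs_ge R w radius_prog _ T _ n (fun r => spreads L q e r)).
  - by [].
  - apply: card_not_spreads => //.
    have : (L <= n + tot_deg adj + 1)%N by lia.
    rewrite /T; move: (n + _ + 1)%N => z Lz.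
    by have := leq_mul (leqnn (q * L)) Lz; lia.
  - by move=> r sp; apply: (run_dense _ _ _ _ _ _ nt q1 q2 L1 L2 q0 L0) => //;
      exact: size_tuple.
have m1 : (0 < #|edge_set e|)%N.
  by have := tot_deg_le_edges adjP ei; lia.
rewrite (maxn_idPl m1); set m := #|edge_set e|.
have qR : q%:R <= 2 * Num.sqrt (k * n)%:R :> R.
  apply: sqrt_up_le; first by rewrite muln_gt0 n0 andbT ltnW.
  by apply: leq_trans q2 _; rewrite leq_mul2r geq_minl orbT.
have LR : L%:R <= 2 / ln 2 * ln n%:R :> R.
  by rewrite mulrAC ler_pdivlMr // log_up_le.
(* Both n and the total degree are at most 2 m, and m >= 1. *)
have szR : (n + tot_deg adj + 1)%:R <= 6 * m%:R :> R.
  rewrite -[6]/(6%:R) -natrM ler_nat; have := tot_deg_le_edges adjP ei.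
  by rewrite -/m; lia.
have -> : 2000 * 24 / ln 2 * m%:R * Num.sqrt (k * n)%:R * ln n%:R
    = 2000 * ((2 * Num.sqrt (k * n)%:R) * (2 / ln 2 * ln n%:R) * (6 * m%:R)) :> R.
  by move: (2000 : R) => c; ring.
rewrite /T !natrM ler_wpM2l ?ler0n //.
apply: ler_pM szR; rewrite ?mulr_ge0 ?ler0n //.
by rewrite natrM in qR; apply: ler_pM qR LR; rewrite ler0n.
Qed.
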